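(* Let $(m_k)_k$ and $(n_k)_k$ be arbitrary sequences of positive integers with $m_k,n_k\ge k$ and $\lim_{k\to\infty}\frac{m_k}{n_k}\in(\frac23,1)$. Then $$\lim_{k\to\infty}\frac1{n_k}\sum_{(r,\alpha)\in\widehat{\mathcal{W}}\cap\Lambda_{m_k,n_k}}\mathcal{S}_{m_k,n_k}(r,\alpha)=1.$$
   Context: $S_2(p,q)$, for $p,q\in\mathbb{N}_0$, denotes the $2$-associated Stirling number of the second kind: the number of ways to partition a set of $p$ elements into $q$ subsets each containing at least 2 elements (so $S_2(0,0)=1$, $S_2(p,0)=0$ for $p\ge1$, $S_2(p,q)=0$ for $q>p/2$). $\widehat{\mathcal{W}}=[\frac13,1]\times[0,1]$, and for $m,n\in\mathbb{N}$ $$\Lambda_{m,n}=\begin{pmatrix}\frac{2}{3m}&0\\0&\frac1n\end{pmatrix}\mathbb{Z}^2+\begin{pmatrix}1\\0\end{pmatrix}.$$ For $(r,\alpha)\in\widehat{\mathcal{W}}\cap\Lambda_{m,n}$, $$\mathcal{S}_{m,n}(r,\alpha)=n\,2^{m-n}\,3^{\frac32(1-r)m}\binom{m}{\frac32(1-r)m}\frac{S_2(3rm,\alpha n)\,S_2\big(3(1-r)m,(1-\alpha)n\big)}{S_2(3m,n)}.$$ (All arguments of the binomial coefficient and of $S_2$ are non-negative integers on this grid.) *)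

(* Defs.v *)
From HB Require Import structures.
From mathcomp Require Import all_boot all_order all_algebra.

Set Implicit Arguments.
Unset Strict Implicit.
Unset Printing Implicit Defensive.

(* 2-associated Stirling number of the second kind.  It is defined before the
   classical sets are imported: partition and [set _ | _] are those of finset. *)
Definition S2 (p q : nat) : nat :=
  #|[set P : {set {set 'I_p}} |
      [&& partition P [set: 'I_p], #|P| == q
        & [forall B in P, (2 <= #|B|)%N]]]|.

From mathcomp Require Import all_classical all_reals all_analysis.
From mathcomp Require Import ring lra.

Import Order.TTheory GRing.Theory Num.Theory.
Import numFieldNormedType.Exports.

Local Open Scope classical_set_scope.
Local Open Scope ring_scope.

Definition What (R : realType) : set (R * R) :=
  [set x | (3^-1 <= x.1 <= 1) && (0 <= x.2 <= 1)].

Definition Lambda (R : realType) (m n : nat) : set (R * R) :=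
  [set x | exists i j : int,
      x = (2 / (3 * m%:R) * i%:~R + 1, n%:R^-1 * j%:~R)].

Arguments What R : clear implicits.
Arguments Lambda R m n : clear implicits.

(* The real arguments of the binomial coefficient and of S2 are turned into
   natural numbers by truncn, which does not change them at the points of
   What `&` Lambda m n: see the lemma Smn_args_nat below. *)
Definition Smn (R : realType) (m n : nat) (x : R * R) : R :=
  let r := x.1 in let alpha := x.2 in
  n%:R * 2 `^ (m%:R - n%:R) * 3 `^ (3 / 2 * (1 - r) * m%:R)
  * 'C(m, Num.truncn (3 / 2 * (1 - r) * m%:R))%:R
  * ((S2 (Num.truncn (3 * r * m%:R)) (Num.truncn (alpha * n%:R)))%:R
     * (S2 (Num.truncn (3 * (1 - r) * m%:R))
           (Num.truncn ((1 - alpha) * n%:R)))%:R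
     / (S2 (3 * m) n)%:R).

Lemma grid_param (R : realType) (m n : nat) (hm : (0 < m)%N) (hn : (0 < n)%N)
    (x : R * R) : (What R `&` Lambda R m n) x ->
  exists (l : 'I_m.+1) (j : 'I_n.+1),
    x = (1 - 2 / (3 * m%:R) * l%:R, n%:R^-1 * j%:R).
Proof.
have m0 : 0 < m%:R :> R by rewrite ltr0n.
have n0 : 0 < n%:R :> R by rewrite ltr0n.
case=> hW [i [j xE]]; move: hW; rewrite xE /What /=.
set d : R := 2 / (3 * m%:R) => /andP[/andP[r1 r2] /andP[a1 a2]].
have d0 : 0 < d by rewrite divr_gt0 // mulr_gt0.
have dm : d * m%:R = 2 / 3 by rewrite /d; field; rewrite gt_eqF.
have i0 : i <= 0.
  rewrite -(lerz0 R) -(ler_pM2l d0) mulr0; lra.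
have im : - i <= m%:Z.
  rewrite -(ler_int R) -(ler_pM2l d0) mulrNz mulrN; rewrite -pmulrn dm; lra.
have j0 : 0 <= j.
  by rewrite -(ler0z R) -(pmulr_rge0 _ (x := n%:R^-1)) // invr_gt0.
have jn : j <= n%:Z.
  rewrite -(ler_int R) -pmulrn.
  by move: a2; rewrite mulrC ler_pdivrMr // mul1r.
have [l lE] : exists l : nat, - i = l%:Z.
  by exists `|i|%N; rewrite lez0_abs.
have [t tE] : exists t : nat, j = t%:Z.
  by exists `|j|%N; rewrite gez0_abs.
have lm : (l < m.+1)%N by rewrite ltnS -lez_nat -lE.
have tn : (t < n.+1)%N by rewrite ltnS -lez_nat -tE.
exists (Ordinal lm), (Ordinal tn) => /=.
rewrite tE -(opprK i) lE mulrNz mulrN -!pmulrn.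
by rewrite addrC.
Qed.

(* In particular the sum over the grid, written with the finitely supported
   big operator, is a genuine finite sum. *)
Lemma finite_grid (R : realType) (m n : nat) :
  (0 < m)%N -> (0 < n)%N -> finite_set (What R `&` Lambda R m n).
Proof.
move=> hm hn.
apply: (@sub_finite_set _ _ (range (fun lj : 'I_m.+1 * 'I_n.+1 =>
  (1 - 2 / (3 * m%:R) * lj.1%:R, n%:R^-1 * lj.2%:R) : R * R))).
  move=> x /(grid_param hm hn)[l [j ->]].
  by exists (l, j).
by apply: finite_image; exact: finite_finset.
Qed.

Lemma Smn_args_nat (R : realType) (m n : nat) (x : R * R) :
  (0 < m)%N -> (0 < n)%N -> (What R `&` Lambda R m n) x ->
  [/\ 3 / 2 * (1 - x.1) * m%:R \is a Num.nat,
      3 * x.1 * m%:R \is a Num.nat, 3 * (1 - x.1) * m%:R \is a Num.nat,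
      x.2 * n%:R \is a Num.nat & (1 - x.2) * n%:R \is a Num.nat].
Proof.
move=> hm hn /(grid_param hm hn)[l [j ->]] /=.
have m0 : m%:R != 0 :> R by rewrite pnatr_eq0 -lt0n.
have n0 : n%:R != 0 :> R by rewrite pnatr_eq0 -lt0n.
have lm : (l <= m)%N by rewrite -ltnS.
have jn : (j <= n)%N by rewrite -ltnS.
split; apply/natrP.
- by exists l; field.
- exists (3 * m - 2 * l)%N; rewrite natrB; last exact: leq_mul.
  by rewrite !natrM; field.
- by exists (2 * l)%N; rewrite natrM; field.
- by exists j; field.
- by exists (n - j)%N; rewrite natrB //; field.
Qed.

(* Main.v *)
Require Import Defs.
From HB Require Import structures.
From mathcomp Require Import all_boot all_order all_algebra.
From mathcomp Require Import ring lra zify.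

Set Implicit Arguments.
Unset Strict Implicit.
Unset Printing Implicit Defensive.

Import Order.TTheory GRing.Theory Num.Theory.

Local Open Scope ring_scope.

(** Divided by n, the sum is 2^(m - n) times the expected number of
    vectors in the kernel, over the field with two elements, of the incidence
    matrix of m clauses with three slots each and n variables, the slots being
    filled uniformly under the condition that every variable occurs at least
    twice. A matrix and its transpose have the same rank, so this is also the
    expected number of even sets, the sets of clauses that meet every variable
    an even number of times. The empty set accounts for 1, and the theorem says
    that the nonempty even sets account for o(1).

    The passage to even sets is the MacWilliams identity [duality]. It turns a
    sum with large cancellations in its exponents into a sum over the size l
    alone, whose term [even_sets] is nonnegative ([even_enum_ge0]) and is 1 at
    l = 0. The term is bounded, for every s in [-1, 1], by a Chernoff bound
    ([even_sets_chernoff]) in terms of the expectation of the product of the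
    (1 + s^d) / 2 over the degrees d of the variables.

    The degrees are independent variables with weights 1 / d!, d >= 2,
    conditioned to have sum 3 m. The weights are log-concave, which has two
    consequences. The degrees are negatively dependent, so that for s >= 0 the
    expectation of the product is at most the product of the expectations; and
    the degree minus 2, whose mean is t = 3 m / n - 2, has a generating function
    at most that of the geometric law of same mean ([negative_dependence]).
    Thus the base of the exponential is at most
    (1 + s^2 / (1 + t (1 - s))) / 2, which is log-convex in t. As 0 < t < 1, the
    inequality that makes the terms with l of the order of m small is needed
    only at t = 0 and t = 1, where it is a polynomial inequality
    ([profile_excess0], [profile_excess1]). It is strict at t = 0 but not at
    t = 1, where it is an equality for l = m / 2: the number m / n has to stay
    away from 1.

    Two ranges need more care. For small l the Chernoff bound has to be used
    without losing a polynomial factor; this is possible because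
    C(m, l)^3 <= C(3 m, 3 l) ([even_sets_small]). For l close to m the number s
    is close to -1, and the absolute value of s says nothing any more; there
    the parities of the degrees make the expectation exponentially small as
    soon as t > 0 ([weight_neg_bound], [even_sets_large]). *)

(** * Partitions into blocks of size at least two *)

Definition thick_partitions (T : finType) (A : {set T}) (q : nat) :
    {set {set {set T}}} :=
  [set P | [&& partition P A, #|P| == q & [forall B in P, (2 <= #|B|)%N]]].

Lemma card_thick_partitions0 (T : finType) (A : {set T}) :
  #|thick_partitions A 0| = (#|A| == 0)%N :> nat.
Proof.
case: (eqVneq #|A| 0%N) => [/cards0_eq -> | A0] /=.
  rewrite -(cards1 (set0 : {set {set T}})); congr #|pred_of_set _|.
  apply/setP=> P; rewrite !inE partition_set0 cards_eq0.
  case: eqP => //= ->.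
  by apply/forallP=> B; rewrite inE.
apply/eqP; rewrite cards_eq0; apply/eqP/setP=> P; rewrite !inE.
apply/negP=> /and3P[partP]; rewrite cards_eq0 => /eqP P0.
by move: partP A0; rewrite P0 => /cover_partition <-; rewrite /cover big_set0 cards0 eqxx.
Qed.

Lemma thick_partitions_rem (T : finType) (A B : {set T}) q :
  B \subset A -> (2 <= #|B|)%N ->
  #|[set P in thick_partitions A q.+1 | B \in P]| =
  #|thick_partitions (A :\: B) q|.
Proof.
move=> BA B2.
have B0 : B != set0 by rewrite -cards_eq0 -lt0n (leq_trans _ B2).
have BD Q : Q \in thick_partitions (A :\: B) q -> B \notin Q.
  rewrite !inE => /and3P[partQ _ _]; apply/negP => BQ.
  have := partitionS partQ BQ; rewrite subsetD => /andP[_].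
  by rewrite -setI_eq0 setIid (negPf B0).
have -> : [set P in thick_partitions A q.+1 | B \in P] =
          (fun Q => B |: Q) @: thick_partitions (A :\: B) q.
  apply/setP=> P; apply/idP/imsetP => [|[Q Qin ->]].
    rewrite !inE => /andP[/and3P[partP /eqP cP /forallP thP] BP].
    exists (P :\ B); last by rewrite setD1K.
    rewrite !inE partitionD1 //=; apply/andP; split.
      by move: cP; rewrite (cardsD1 B) BP add1n => -[->].
    by apply/forallP=> C; rewrite !inE; apply/implyP=> /andP[_ CP];
      exact: (implyP (thP C)).
  have BQ := BD _ Qin; move: Qin; rewrite !inE eqxx /= andbT.
  move=> /and3P[partQ /eqP cQ /forallP thQ]; apply/and3P; split.
  - have <- : B :|: (A :\: B) = A.
      apply/setP=> x; rewrite !inE; case Bx: (x \in B) => //=.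
      by rewrite (subsetP BA).
    apply: partitionU1 => //; rewrite -setI_eq0; apply/eqP/setP=> x.
    by rewrite !inE; case: (x \in B).
  - by rewrite cardsU1 BQ cQ.
  - apply/forallP=> C; rewrite !inE; apply/implyP=> /orP[/eqP -> //|CQ].
    exact: (implyP (thQ C)).
rewrite card_in_imset // => Q1 Q2 /BD B1 /BD B2' /(congr1 (fun Q => Q :\ B)).
by rewrite !setU1K.
Qed.

(** Pairs formed of a partition and one of its blocks, counted in two ways. *)
Lemma thick_partitions_rec (T : finType) (A : {set T}) q :
  (q.+1 * #|thick_partitions A q.+1| =
   \sum_(B : {set T} | (B \subset A) && (2 <= #|B|)) #|thick_partitions (A :\: B) q|)%N.
Proof.
transitivity (\sum_(P in thick_partitions A q.+1) \sum_(B in P) 1)%N.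
  rewrite mulnC -sum_nat_const; apply: eq_bigr => P.
  by rewrite sum1_card inE => /and3P[_ /eqP -> _].
rewrite (exchange_big_dep (fun B : {set T} => (B \subset A) && (2 <= #|B|)%N)) /=.
  apply: eq_bigr => B /andP[BA B2].
  rewrite -(thick_partitions_rem q BA B2) -sum1_card.
  by apply: eq_bigl => P; rewrite !inE.
move=> P B; rewrite inE => /and3P[partP _ /forallP/(_ B)/implyP th] BP.
by rewrite th // andbT; exact: (partitionS partP BP).
Qed.

(** * The exponential generating function of S2 *)

Section GeneratingFunction.
Variable R : realFieldType.

(** The series (e^z - 1 - z) / z^2, truncated: only its coefficients of index
    below D matter, and polynomials stand for power series throughout. *)
Definition tailser (D : nat) : {poly R} := \poly_(k < D) ((k.+2)`!%:R)^-1.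

(** The series e^z - 1 - z, truncated. *)
Definition blockser (D : nat) : {poly R} := 'X^2 * tailser D.

Lemma coef_blockser D k : (k < D.+2)%N ->
  (blockser D)`_k = if (2 <= k)%N then (k`!%:R)^-1 else 0.
Proof.
move=> kD; rewrite coefXnM ltnNge; case: leqP => //= k2.
rewrite coef_poly ifT; last by lia.
by have -> : ((k - 2).+2 = k)%N by lia.
Qed.

Lemma fact_neq0 k : k`!%:R != 0 :> R.
Proof. by rewrite pnatr_eq0 -lt0n fact_gt0. Qed.

Lemma fact_gt0r k : 0 < k`!%:R :> R.
Proof. by rewrite ltr0n fact_gt0. Qed.

Lemma bin_fact_R p k : (k <= p)%N ->
  'C(p, k)%:R = p`!%:R / (k`!%:R * (p - k)`!%:R) :> R.
Proof.
move=> kp; apply: (mulIf (mulf_neq0 (fact_neq0 k) (fact_neq0 (p - k)))).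
by rewrite divfK ?mulf_neq0 ?fact_neq0 // -!natrM bin_fact.
Qed.

Lemma card_thick_partitions (T : finType) D q (A : {set T}) : (#|A| < D.+2)%N ->
  (q`! * #|thick_partitions A q|)%:R = #|A|`!%:R * (blockser D ^+ q)`_#|A| :> R.
Proof.
elim: q A => [|q IHq] A AD.
  rewrite mul1n card_thick_partitions0 expr0 coef1.
  by case: eqVneq => [->|]; rewrite /= ?mulr1 ?mulr0.
rewrite factS -mulnA [(_ * (q`! * _))%N]mulnCA thick_partitions_rec natrM natr_sum mulr_sumr.
under eq_bigr => B /andP[BA B2].
  rewrite -natrM IHq; last by rewrite (leq_ltn_trans _ AD) // subset_leq_card // subsetDl.
  rewrite cardsD (setIidPr BA).
  over.
pose F k : R := if (2 <= k)%N
  then (#|A| - k)`!%:R * (blockser D ^+ q)`_(#|A| - k) else 0.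
transitivity (\sum_(B : {set T} | B \subset A) F #|B|).
  rewrite -big_mkcondr /=; apply: eq_bigl => B; by [].
rewrite (partition_big (fun B : {set T} => inord #|B| : 'I_(#|A|.+1)) predT) //=.
rewrite exprS coefM mulr_sumr; apply: eq_bigr => k _.
have kA : (k <= #|A|)%N by rewrite -ltnS.
transitivity (\sum_(B in [set B0 : {set T} | B0 \subset A & #|B0| == k]) F k).
  have inA (B : {set T}) :
      (B \subset A) && (inord #|B| == k) = (B \in [set B0 : {set T} | B0 \subset A & #|B0| == k]).
    rewrite inE; case BA: (B \subset A) => //=.
    by rewrite -val_eqE /= inordK // ltnS; exact: subset_leq_card.
  rewrite (eq_bigl _ _ inA); apply: eq_bigr => B.
  by rewrite inE => /andP[_ /eqP ->].
rewrite sumr_const cards_draws /F coef_blockser; last first.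
  by rewrite (leq_ltn_trans kA).
case: (leqP 2 k) => k2; rewrite ?mul0r ?mulr0 ?mul0rn // -[LHS]mulr_natl.
rewrite bin_fact_R //; field.
by rewrite !fact_neq0.
Qed.

Lemma S2_blockser D p q : (p < D.+2)%N ->
  (S2 p q)%:R = p`!%:R / q`!%:R * (blockser D ^+ q)`_p :> R.
Proof.
move=> pD; have := @card_thick_partitions 'I_p D q [set: 'I_p].
rewrite cardsT card_ord natrM => /(_ pD) h.
apply: (mulfI (fact_neq0 q)); rewrite [LHS]h; field; exact: fact_neq0.
Qed.

End GeneratingFunction.

(** * Log-concave sequences *)

Section LogConcave.
Variable R : realFieldType.
Implicit Types (a b c p : {poly R}).

(** The order-two Cauchy-Binet formula: antisymmetrizing the double sum in x
    and y turns the difference of the two sides into half the sum of the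
    products in the hypothesis. *)
Lemma sum_mul_le_of_minors M (a b c d : 'I_M -> R) :
  (forall x y : 'I_M, (x < y)%N ->
     (b x * a y - b y * a x) * (c x * d y - c y * d x) <= 0) ->
  (\sum_x b x * c x) * (\sum_x a x * d x) <=
  (\sum_x b x * d x) * (\sum_x a x * c x).
Proof.
move=> h; pose D x y := b x * a y * (c x * d y - d x * c y).
have E : (\sum_x b x * c x) * (\sum_x a x * d x) -
  (\sum_x b x * d x) * (\sum_x a x * c x) = \sum_x \sum_y D x y.
  rewrite !mulr_suml -sumrB; apply: eq_bigr => x _.
  by rewrite !mulr_sumr -sumrB; apply: eq_bigr => y _; rewrite /D; ring.
have two_gt0 : 0 < 2 :> R by [].
rewrite -subr_le0 E -(pmulr_rle0 _ two_gt0) mulr_natl mulr2n.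
rewrite [X in _ + X]exchange_big -big_split sumr_le0 //= => x _.
rewrite -big_split sumr_le0 //= => y _.
have -> : D x y + D y x = (b x * a y - b y * a x) * (c x * d y - c y * d x).
  by rewrite /D; ring.
case: (ltngtP x y) => [/h //|/h|/val_inj ->]; last by rewrite subrr mul0r.
by move=> le0; rewrite -mulrNN !opprB.
Qed.

Definition logconc c : Prop :=
  (forall i, 0 <= c`_i) /\
  (forall i j, (i <= j)%N -> c`_i * c`_j.+1 <= c`_i.+1 * c`_j).

(** The ratio b / a is nonincreasing; the product form needs no convention
    about vanishing coefficients. *)
Definition ratio_noninc b a : Prop :=
  forall i j, (i <= j)%N -> b`_j * a`_i <= b`_i * a`_j.

Lemma logconc_gap c i j d : logconc c -> (i <= j)%N ->
  c`_i * c`_(j + d) <= c`_(i + d) * c`_j.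
Proof.
move=> [c0 lc]; elim: d i j => [|d IH] i j ij; first by rewrite !addn0.
move: (ij); rewrite leq_eqVlt => /predU1P[->|ltij]; first by rewrite mulrC.
rewrite [(j + _)%N]addnS (le_trans (lc _ _ (leq_trans ij (leq_addr d j)))) //.
by rewrite -addSnnS IH.
Qed.

Lemma coefXnM_gap c i x : ('X^x * c)`_i = if (x <= i)%N then c`_(i - x) else 0.
Proof. by rewrite coefXnM ltnNge; case: leqP. Qed.

Lemma logconc_minor c i j x y : logconc c -> (i <= j)%N -> (x <= y)%N ->
  ('X^x * c)`_j * ('X^y * c)`_i <= ('X^x * c)`_i * ('X^y * c)`_j.
Proof.
move=> lc ij xy; have [c0 _] := lc; rewrite !coefXnM_gap.
case: (leqP y i) => yi; last first.
  by rewrite mulr0 mulr_ge0 //; case: ifP.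
rewrite !ifT; try lia.
have := @logconc_gap c (i - y) (i - y + (y - x)) (j - i) lc (leq_addr _ _).
have -> : (i - y + (y - x) + (j - i) = j - x)%N by lia.
have -> : (i - y + (j - i) = j - y)%N by lia.
have -> : (i - y + (y - x) = i - x)%N by lia.
by rewrite mulrC [X in _ <= X]mulrC.
Qed.

Lemma coefM_widen a c i M : (i < M)%N ->
  (a * c)`_i = \sum_(x < M) a`_x * ('X^x * c)`_i.
Proof.
move=> iM; rewrite coefM (big_ord_widen M (fun x => a`_x * c`_(i - x))) //.
rewrite big_mkcond; apply: eq_bigr => x _.
by rewrite coefXnM_gap ltnS; case: leqP => // _; rewrite mulr0.
Qed.

(** Convolution with a log-concave sequence has a kernel which is totally
    positive of order two, hence preserves the monotonicity of ratios. *)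
Lemma ratio_nonincM b a c : ratio_noninc b a -> logconc c ->
  ratio_noninc (b * c) (a * c).
Proof.
move=> ba lc i j ij; rewrite !(coefM_widen _ _ (ltnSn j)).
rewrite !(coefM_widen _ _ (ij : (i < j.+1)%N)).
apply: sum_mul_le_of_minors => x y /ltnW xy.
apply: mulr_ge0_le0; first by rewrite subr_ge0; exact: ba.
by rewrite subr_le0 [X in _ <= X]mulrC; exact: logconc_minor.
Qed.

(** Written as a comparison with the shifted sequence, log-concavity becomes
    stable under products by [ratio_nonincM]. *)
Lemma logconcE c :
  logconc c <-> (forall i, 0 <= c`_i) /\ ratio_noninc c ('X * c).
Proof.
split=> -[c0 lc]; split=> // i j ij.
  rewrite !coefXM; case: i j ij => [|i] [|j] ij //=; first by rewrite mulr0 mulr_ge0.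
  by rewrite mulrC; apply: lc.
have := lc i.+1 j.+1 ij; rewrite !coefXM /=; by rewrite mulrC.
Qed.

Lemma logconcM a c : logconc a -> logconc c -> logconc (a * c).
Proof.
move=> la lc; have [a0 ra] := (logconcE a).1 la.
apply/logconcE; split=> [i|]; last by rewrite mulrA; exact: ratio_nonincM.
by rewrite coefM sumr_ge0 // => x _; rewrite mulr_ge0 ?a0 //; case: lc.
Qed.

Lemma logconc1 : logconc (1 : {poly R}).
Proof.
by split=> [i|i j ij]; rewrite !coef1 ?ler0n //= mulr0 mul0r.
Qed.

Lemma logconcX a n : logconc a -> logconc (a ^+ n).
Proof.
by move=> la; elim: n => [|n IH]; rewrite ?expr0 ?exprS;
  [exact: logconc1 | exact: logconcM].
Qed.

(** ** Negative dependence under conditioning on the sum *)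

Section NegativeDependence.
Variables (a b : {poly R}) (N : nat).
Hypotheses (la : logconc a) (lb : logconc b) (ba : ratio_noninc b a).
Hypothesis le_ba : forall i, b`_i <= a`_i.

(** The ratios b / a at x and (b h) / (a h) at N - x vary in opposite ways. *)
Lemma mixed_coef_logconc h : logconc h ->
  (b * (b * h))`_N * (a * (a * h))`_N <= (b * (a * h))`_N * (a * (b * h))`_N.
Proof.
move=> lh; have rh := ratio_nonincM ba lh; rewrite !coefM.
apply: sum_mul_le_of_minors => x y xy.
apply: mulr_ge0_le0; first by rewrite subr_ge0; exact/ba/ltnW.
by rewrite subr_le0; apply: rh; rewrite leq_sub2l // ltnW.
Qed.

(** Up to a factor, the expectation of the product of j of the n ratios b / a,
    when n variables of weights a are conditioned to have sum N. *)
Let q n j := (b ^+ j * a ^+ (n - j))`_N.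

Let coef_ge0 c : logconc c -> 0 <= c`_N. Proof. by case. Qed.

Lemma mixed_ge0 n j : 0 <= q n j.
Proof. by apply/coef_ge0/logconcM; exact: logconcX. Qed.

Lemma mixed_le n j : (j < n)%N -> q n j.+1 <= q n j.
Proof.
move=> jn; rewrite /q -(subnSK jn) !exprS -mulrA [b ^+ j * (a * _)]mulrCA.
rewrite !coefM; apply: ler_sum => i _; apply: ler_wpM2r => //.
by have [] : logconc (b ^+ j * a ^+ (n - j.+1)) by apply/logconcM; exact: logconcX.
Qed.

Lemma mixed_step n j : (j.+1 < n)%N -> q n j.+2 * q n j <= q n j.+1 ^+ 2.
Proof.
move=> jn; have lh : logconc (b ^+ j * a ^+ (n - j.+2)).
  by apply: logconcM; exact: logconcX.
have := mixed_coef_logconc lh; rewrite expr2 /q.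
have -> : (n - j = (n - j.+2).+2)%N by lia.
have -> : (n - j.+1 = (n - j.+2).+1)%N by lia.
rewrite !exprS; set B := b ^+ j; set A := a ^+ _.
have -> : b * (b * (B * A)) = b * (b * B) * A by ring.
have -> : a * (a * (B * A)) = B * (a * (a * A)) by ring.
have -> : b * (a * (B * A)) = b * B * (a * A) by ring.
by have -> : a * (b * (B * A)) = b * B * (a * A) by ring.
Qed.

Lemma mixed_ratio n j : (j < n)%N -> q n j.+1 * q n 0 <= q n j * q n 1.
Proof.
elim: j => [|j IH] jn; first by rewrite mulrC.
have q0 := mixed_ge0 n; have := q0 j; rewrite le_eqVlt => /predU1P[qj0|qj_gt0].
  (* Without a division by q n j: past a zero all terms vanish. *)
  have -> : q n j.+2 = 0.
    apply/eqP; rewrite eq_le q0 andbT.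
    by rewrite (le_trans (mixed_le jn)) // (le_trans (mixed_le (ltnW jn))) // -qj0.
  by rewrite mul0r mulr_ge0.
rewrite -(ler_pM2r qj_gt0).
have h1 := ler_wpM2r (q0 0%N) (mixed_step jn).
have h2 := ler_wpM2l (q0 j.+1) (IH (ltnW jn)).
rewrite (_ : _ * _ * _ = q n j.+2 * q n j * q n 0); last by ring.
apply: (le_trans h1); rewrite expr2 -mulrA (le_trans h2) //.
by rewrite le_eqVlt; apply/orP; left; apply/eqP; ring.
Qed.

(** Log-concavity of q in j, from j = 0 and j = 1 on. *)
Lemma mixed_power n j : 0 < q n 0 -> (j <= n)%N ->
  q n j <= q n 0 * (q n 1 / q n 0) ^+ j.
Proof.
move=> q0; elim: j => [|j IH] jn; first by rewrite expr0 mulr1.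
rewrite exprS mulrCA -(ler_pM2r q0) (le_trans (mixed_ratio jn)) //.
rewrite mulrC [q n 1 / _ * _ * _]mulrAC divfK ?gt_eqF //.
by apply: ler_wpM2l (IH (ltnW jn)); exact: mixed_ge0.
Qed.

(** The n weights alpha + gamma b / a are handled by expanding their product. *)
Lemma mixed_expect n (alpha gamma : R) : 0 <= alpha -> 0 <= gamma ->
    0 < (a ^+ n)`_N ->
  ((alpha *: a + gamma *: b) ^+ n)`_N <=
  (a ^+ n)`_N * (alpha + gamma * ((b * a ^+ n.-1)`_N / (a ^+ n)`_N)) ^+ n.
Proof.
move=> al0 ga0 U0.
have q0E : q n 0 = (a ^+ n)`_N by rewrite /q mul1r subn0.
have q1E : q n 1 = (b * a ^+ n.-1)`_N by rewrite /q expr1 subn1.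
rewrite !exprDn coef_sum mulr_sumr; apply: ler_sum => j _.
rewrite coefMn mulrnAr lerMn2r; apply/orP; right.
rewrite !exprZn -scalerAl -scalerAr !coefZ [a ^+ _ * _]mulrC.
rewrite -/(q n j) -q0E -q1E exprMn; set r := q n 1 / q n 0.
rewrite mulrA [X in _ <= X](_ : _ = alpha ^+ (n - j) * gamma ^+ j * (q n 0 * r ^+ j)); last by ring.
apply: ler_wpM2l; first by rewrite mulr_ge0 ?exprn_ge0.
by apply: mixed_power; rewrite ?q0E // -ltnS.
Qed.
End NegativeDependence.

(** ** Comparison with the geometric law *)

(** A log-concave law has an increasing hazard rate, so that it dominates the
    law proportional to its tails; this makes its generating function at most
    that of the geometric law of same mean. *)
Lemma geometric_bound p (s : R) : logconc p -> 0 <= s <= 1 ->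
  p.[s] * (p.[1] + (1 - s) * p^`().[1]) <= p.[1] ^+ 2.
Proof.
move=> lp /andP[s0 s1]; have [p0 _] := lp.
pose M := size p; pose S (k : nat) := \sum_(k.+1 <= i < M) p`_i.
have SE k : S k = \sum_(i < M | (k < i)%N) p`_i by rewrite /S big_geq_mkord.
pose H (x : R) := \sum_(k < M) S k * x ^+ k.
have HE x : H x = \sum_(i < M) p`_i * \sum_(k < i) x ^+ k.
  transitivity (\sum_(k < M) \sum_(i < M | (k < i)%N) p`_i * x ^+ k).
    by apply: eq_bigr => k _; rewrite SE mulr_suml.
  rewrite (exchange_big_dep xpredT) //=; apply: eq_bigr => i _; rewrite mulr_sumr.
  by rewrite (big_ord_widen M (fun k => p`_i * x ^+ k)) // ltnW.
have Hs : p.[1] - p.[s] = (1 - s) * H s.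
  rewrite !horner_coef -sumrB HE mulr_sumr; apply: eq_bigr => i _.
  by rewrite expr1n mulrCA -mulrBr -[1 - s]opprB mulNr -subrX1 opprB.
have H1 : H 1 = p^`().[1].
  rewrite HE -[in RHS](coefK p) poly_def raddf_sum horner_sum; apply: eq_bigr => i _.
  rewrite /= derivZ derivXn hornerZ hornerMn hornerXn expr1n; congr (_ * _).
  by under eq_bigr do rewrite expr1n; rewrite sumr_const card_ord.
have key : H 1 * p.[s] <= H s * p.[1].
  rewrite !horner_coef; apply: sum_mul_le_of_minors => x y xy.
  apply: mulr_ge0_le0; last first.
    by rewrite !expr1n !mul1r subr_le0 ler_wiXn2l // ltnW.
  rewrite subr_ge0 /S -[y.+1]add0n -[x.+1]add0n !big_addn !mulr_suml.
  have le_My : (M - y.+1 <= M - x.+1)%N by rewrite leq_sub2l // ltnW.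
  rewrite [X in _ <= X](@big_cat_nat _ _ _ (M - y.+1)) //= -[X in X <= _]addr0.
  apply: lerD; last by apply: sumr_ge0 => i _; rewrite mulr_ge0.
  apply: ler_sum => i _; rewrite mulrC !(addnC i) !addSnnS.
  by apply: logconc_gap => //; exact: ltnW.
rewrite -H1 mulrDr [p.[s] * (_ * _)]mulrCA [p.[s] * H 1]mulrC.
rewrite -subr_ge0.
have -> : p.[1] ^+ 2 - (p.[s] * p.[1] + (1 - s) * (H 1 * p.[s])) =
  (1 - s) * (H s * p.[1] - H 1 * p.[s]) + (p.[1] - p.[s] - (1 - s) * H s) * p.[1].
  by ring.
by rewrite Hs subrr mul0r addr0 mulr_ge0 // subr_ge0.
Qed.

(** ** Generating function of a sum of dependent variables *)

Definition dilate (S : comNzRingType) (s : S) (p : {poly S}) := p \Po (s *: 'X).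

Lemma coef_dilate (S : comNzRingType) (s : S) (p : {poly S}) i :
  (dilate s p)`_i = s ^+ i * p`_i.
Proof.
rewrite coef_comp_poly; have [ip|pi] := ltnP i (size p).
  rewrite (bigD1 (Ordinal ip)) //= exprZn coefZ coefXn eqxx mulr1 mulrC.
  rewrite big1 ?addr0 // => j; rewrite -val_eqE /= => ji.
  by rewrite exprZn coefZ coefXn eq_sym (negPf ji) !mulr0.
rewrite nth_default // mulr0 big1 // => j _; rewrite exprZn coefZ coefXn.
by rewrite gtn_eqF ?mulr0 // (leq_trans (ltn_ord j)).
Qed.

Lemma dilateX (S : comNzRingType) (s : S) (p : {poly S}) n :
  dilate s p ^+ n = dilate s (p ^+ n).
Proof. by rewrite /dilate rmorphXn. Qed.

Lemma dilateM (S : comNzRingType) (s : S) (p q : {poly S}) :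
  dilate s (p * q) = dilate s p * dilate s q.
Proof. exact: rmorphM. Qed.

Lemma logconc_dilate (s : R) a : 0 <= s -> logconc a -> logconc (dilate s a).
Proof.
move=> s0 [a0 la]; split=> [i|i j ij]; rewrite !coef_dilate.
  by rewrite mulr_ge0 ?exprn_ge0.
rewrite mulrACA [X in _ <= X]mulrACA -!exprD addSnnS.
by apply: ler_wpM2l; [exact: exprn_ge0 | exact: la].
Qed.

Lemma ratio_dilate (s : R) a : 0 <= s <= 1 -> (forall i, 0 <= a`_i) ->
  ratio_noninc (dilate s a) a.
Proof.
move=> /andP[s0 s1] a0 i j ij; rewrite !coef_dilate -!mulrA [a`_j * _]mulrC.
by apply: ler_wpM2r; [exact: mulr_ge0 | exact: ler_wiXn2l].
Qed.

(** If n variables of log-concave weights a are conditioned to have sum N, then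
    the law of the first one is log-concave, of mean N / n by symmetry. *)
Lemma marginal_bound a n N (s : R) : logconc a -> 0 <= s <= 1 -> (0 < n)%N ->
  0 < (a ^+ n)`_N ->
  (dilate s a * a ^+ n.-1)`_N / (a ^+ n)`_N <=
  (1 + N%:R / n%:R * (1 - s))^-1.
Proof.
move=> la s01 n0 U0; have [a0 _] := la.
have n0r : 0 < n%:R :> R by rewrite ltr0n.
set U := (a ^+ n)`_N in U0 *.
have lan : logconc (a ^+ n.-1) by exact: logconcX.
pose p := \poly_(k < N.+1) (a`_k * (a ^+ n.-1)`_(N - k)).
have lp : logconc p.
  have [an0 _] := lan; split=> [k|i j ij].
    by rewrite coef_poly; case: ifP => // _; rewrite mulr_ge0.
  rewrite !coef_poly; case: (ltnP j.+1) => jN; last first.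
    by rewrite mulr0 mulr_ge0 //; case: ifP => // _; rewrite mulr_ge0.
  rewrite !ifT; try lia.
  rewrite mulrACA [X in _ <= X]mulrACA; apply: ler_pM; rewrite ?mulr_ge0 //.
    by case: la => _; apply.
  case: lan => _ /(_ (N - j.+1) (N - i.+1))%N.
  have -> : ((N - j.+1).+1 = N - j)%N by lia.
  have -> : ((N - i.+1).+1 = N - i)%N by lia.
  by rewrite mulrC [X in _ <= X]mulrC; apply; lia.
have hp x : p.[x] = \sum_(k < N.+1) a`_k * (a ^+ n.-1)`_(N - k) * x ^+ k.
  by rewrite horner_poly.
have p1 : p.[1] = U.
  rewrite hp /U -(prednK n0) exprS coefM; apply: eq_bigr => k _.
  by rewrite expr1n mulr1.
have ps : p.[s] = (dilate s a * a ^+ n.-1)`_N.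
  by rewrite hp coefM; apply: eq_bigr => k _; rewrite coef_dilate; ring.
have mean : p^`().[1] = N%:R / n%:R * U.
  apply: (mulfI (lt0r_neq0 n0r)); rewrite [RHS](_ : _ = N%:R * U); last first.
    by field; rewrite gt_eqF.
  transitivity (('X * (a ^+ n)^`())`_N); last first.
    rewrite coefXM /U; case: (N) => [|N'] /=; first by rewrite mul0r.
    by rewrite coef_deriv mulr_natl.
  rewrite deriv_exp mulrnAr mulrA coefMn -[RHS]mulr_natl coefM; congr (_ * _).
  rewrite /p poly_def raddf_sum horner_sum; apply: eq_bigr => k _.
  rewrite /= derivZ derivXn hornerZ hornerMn hornerXn expr1n coefXM.
  case: (nat_of_ord k) => [|k'] /=; first by rewrite mulr0 mul0r.
  by rewrite coef_deriv mulr_natr mulrnAl.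
have := geometric_bound lp s01; rewrite -ps mean p1.
have x0 : 0 < 1 + N%:R / n%:R * (1 - s).
  rewrite ltr_pwDl // mulr_ge0 ?divr_ge0 // subr_ge0; by case/andP: s01.
rewrite ler_pdivrMr // [_^-1 * _]mulrC ler_pdivlMr // => h.
rewrite -(ler_pM2r U0) -expr2 (le_trans _ h) // le_eqVlt; apply/orP; left.
by apply/eqP; ring.
Qed.

(** Variables conditioned on their sum are negatively dependent, so that the
    product of the alpha + gamma s^d has at most the expectation that it would
    have under independence, and each factor is bounded by the geometric law. *)
Lemma negative_dependence a n N (s alpha gamma : R) :
  logconc a -> 0 <= s <= 1 -> (0 < n)%N -> 0 < (a ^+ n)`_N ->
  0 <= alpha -> 0 <= gamma ->
  ((alpha *: a + gamma *: dilate s a) ^+ n)`_N <=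
  (a ^+ n)`_N * (alpha + gamma / (1 + N%:R / n%:R * (1 - s))) ^+ n.
Proof.
move=> la s01 n0 U0 al0 ga0; have /andP[s0 s1] := s01; have [a0 _] := la.
have lb := logconc_dilate s0 la; have rb := ratio_dilate s01 a0.
have leb i : (dilate s a)`_i <= a`_i.
  by rewrite coef_dilate ler_piMl // exprn_ile1.
apply: (le_trans (mixed_expect la lb rb leb al0 ga0 U0)).
have dan := logconcM lb (logconcX n.-1 la).
have d0 : 0 <= (dilate s a * a ^+ n.-1)`_N / (a ^+ n)`_N.
  by apply: divr_ge0; [case: dan | exact: ltW].
have le_d := marginal_bound la s01 n0 U0.
have e0 := le_trans d0 le_d.
rewrite ler_pM2l //; apply: lerXn2r.
- by rewrite nnegrE addr_ge0 // mulr_ge0.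
- by rewrite nnegrE addr_ge0 // mulr_ge0.
- by rewrite lerD2l ler_wpM2l.
Qed.
End LogConcave.

(** * The duality between the two kernels *)

Section WeightEnumerator.
Variables (S : comNzRingType) (f : {poly S}) (n N : nat).

(** If n variables have degrees with sum N and weights given by the
    coefficients of f, then this is the total weight of the pairs formed of such
    degrees and a set of variables whose degrees sum to a. *)
Definition split_coef (a : nat) : S :=
  \sum_(j < n.+1) 'C(n, j)%:R * ((f ^+ j)`_(N - a) * (f ^+ (n - j))`_a).

Lemma dilateD_exp x y :
  ((dilate y f + dilate x f) ^+ n)`_N =
  \sum_(a < N.+1) split_coef a * (x ^+ (N - a) * y ^+ a).
Proof.
rewrite exprDn coef_sum.
under eq_bigr => j _.
  rewrite coefMn !dilateX coefM -mulr_natl mulr_sumr.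
  over.
rewrite exchange_big /=; apply: eq_bigr => a _.
rewrite /split_coef mulr_suml; apply: eq_bigr => j _.
by rewrite !coef_dilate; ring.
Qed.

Lemma dilate1 : dilate 1 f = f.
Proof. by apply/polyP=> i; rewrite coef_dilate expr1n mul1r. Qed.
End WeightEnumerator.

Section Krawtchouk.
Variable R : realFieldType.

Definition krawtchouk N a : {poly R} := (1 + 'X) ^+ (N - a) * (1 - 'X) ^+ a.

(** Both sides are coefficients of ((1 + t) + (1 - t) w)^N, which is symmetric
    in t and w. *)
Lemma krawtchouk_sym N a b : (a <= N)%N -> (b <= N)%N ->
  'C(N, a)%:R * (krawtchouk N a)`_b = 'C(N, b)%:R * (krawtchouk N b)`_a.
Proof.
move=> aN bN; pose B : {poly {poly R}} := (1 + 'X)%:P + (1 - 'X)%:P * 'X.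
have coefB i j : (i <= N)%N -> (B ^+ N)`_i`_j = 'C(N, i)%:R * (krawtchouk N i)`_j.
  move=> iN; rewrite exprDn coef_sum.
  have iN' : (i < N.+1)%N by [].
  rewrite (bigD1 (Ordinal iN')) //= big1 => [|k]; last first.
    rewrite -val_eqE /= => ki; rewrite coefMn exprMn -!polyC_exp mulrA -polyCM.
    by rewrite coefCM coefXn eq_sym (negPf ki) mulr0 mul0rn.
  rewrite addr0 coefMn exprMn -!polyC_exp mulrA -polyCM coefCM coefXn eqxx mulr1.
  by rewrite coefMn mulr_natl.
have symB : swapXY B = B.
  rewrite /B rmorphD rmorphM /= !swapXY_polyC swapXY_X !rmorphD !rmorphN /=.
  by rewrite rmorph1 map_polyX polyC1; ring.
by rewrite -coefB // -coefB // -{2}symB -rmorphXn coef_swapXY.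
Qed.

Lemma coef_1subX_exp i j :
  `|(((1 - 'X) : {poly R}) ^+ i)`_j| <= (((1 + 'X) : {poly R}) ^+ i)`_j.
Proof.
elim: i j => [|i IH] j; first by rewrite !expr0 coef1 normr_nat.
rewrite !exprS mulrBl mulrDl !mul1r coefB coefD !coefXM.
case: j => [|j] /=; first by rewrite subr0 addr0.
by rewrite (le_trans (ler_normB _ _)) // lerD.
Qed.

Section Duality.
Variables (f : {poly R}) (n N : nat).
Hypothesis f_ge0 : forall i, 0 <= f`_i.

Local Notation c := (split_coef f n N).

(** Coefficient of t^b: the weight of the ways to choose b of the N half-edges
    meeting every variable an even number of times, times 2^n. *)
Definition even_enum : {poly R} := \sum_(a < N.+1) c a *: krawtchouk N a.

Lemma split_coef_ge0 a : 0 <= c a.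
Proof.
have fX k i : 0 <= (f ^+ k)`_i.
  elim: k i => [|k IH] i; first by rewrite expr0 coef1 ler0n.
  by rewrite exprS coefM sumr_ge0 // => j _; rewrite mulr_ge0.
by apply: sumr_ge0 => j _; rewrite !mulr_ge0.
Qed.

(** Seen as a series in z over the polynomials in t, the series
    f((1 + t) z) + f((1 - t) z) has the nonnegative coefficients
    f_k ((1 + t)^k + (1 - t)^k). *)
Lemma even_enum_ge0 b : 0 <= even_enum`_b.
Proof.
pose G : {poly {poly R}} := dilate (1 - 'X) f^:P + dilate (1 + 'X) f^:P.
have G0 i j : 0 <= G`_i`_j.
  rewrite coefD !coef_dilate coef_map /= -mulrDl mulrC coefCM mulr_ge0 //.
  rewrite coefD.
  have := coef_1subX_exp i j; rewrite ler_norml => /andP[h _].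
  by rewrite -lerBlDr sub0r.
have GX k i j : 0 <= (G ^+ k)`_i`_j.
  elim: k i j => [|k IH] i j; first by rewrite expr0 coef1; case: eqP; rewrite ?coef0 // coef1 ler0n.
  rewrite exprS coefM coef_sum sumr_ge0 // => l _.
  by rewrite coefM sumr_ge0 // => l' _; rewrite mulr_ge0.
have -> : even_enum = (G ^+ n)`_N.
  rewrite dilateD_exp; apply: eq_bigr => a _; rewrite -mul_polyC; congr (_ * _).
  rewrite /split_coef rmorph_sum; apply: eq_bigr => j _.
  by rewrite !rmorphM /= rmorph_nat -!rmorphXn !coef_map.
exact: GX.
Qed.

Lemma even_enum0 : even_enum`_0 = 2 ^+ n * (f ^+ n)`_N.
Proof.
transitivity (((dilate 1 f + dilate 1 f) ^+ n)`_N).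
  rewrite dilateD_exp coef_sum; apply: eq_bigr => a _.
  rewrite coefZ /krawtchouk !expr1n -horner_coef0 hornerM !horner_exp.
  by rewrite !hornerE subr0 !expr1n.
by rewrite dilate1 -[f + f]mulr2n [(f *+ 2) ^+ n]exprMn_n coefMn -natrX mulr_natl.
Qed.

Lemma even_enum_chernoff (u v : R) b : 0 < u -> 0 < v -> u + v = 1 -> (b <= N)%N ->
  even_enum`_b * (u ^+ b * v ^+ (N - b)) <= ((dilate (v - u) f + f) ^+ n)`_N.
Proof.
move=> u0 v0 uv bN.
have v1 : v != 0 by rewrite gt_eqF.
have hor : even_enum.[u / v] * v ^+ N = ((dilate (v - u) f + f) ^+ n)`_N.
  rewrite -{2}(dilate1 f) dilateD_exp /even_enum horner_sum mulr_suml.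
  apply: eq_bigr => a _; have aN : (a <= N)%N by rewrite -ltnS.
  rewrite hornerZ /krawtchouk hornerM !horner_exp -polyC1.
  rewrite !(hornerD, hornerN, hornerX, hornerC) -!mulrA; congr (_ * _).
  rewrite mulrA; have -> : v ^+ N = v ^+ (N - a) * v ^+ a by rewrite -exprD subnK.
  rewrite mulrACA -!exprMn.
  have -> : (1 + u / v) * v = u + v by field.
  have -> : (1 - u / v) * v = v - u by field.
  by rewrite uv.
rewrite -hor (_ : u ^+ b * v ^+ (N - b) = (u / v) ^+ b * v ^+ N); last first.
  have -> : v ^+ N = v ^+ (N - b) * v ^+ b by rewrite -exprD subnK.
  by rewrite expr_div_n; field; rewrite expf_neq0.
rewrite mulrA; apply: ler_wpM2r; first exact/exprn_ge0/ltW.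
have x0 : 0 <= u / v by rewrite divr_ge0 // ltW.
have pos i : 0 <= even_enum`_i * (u / v) ^+ i.
  by rewrite mulr_ge0 ?even_enum_ge0 ?exprn_ge0.
rewrite horner_coef; have [bs|sb] := ltnP b (size even_enum); last first.
  by rewrite nth_default // mul0r; apply: sumr_ge0 => i _; exact: pos.
rewrite (bigD1 (Ordinal bs)) //= lerDl.
by apply: sumr_ge0 => i _; exact: pos.
Qed.
End Duality.

(** The MacWilliams identity for the code of the even sets of clauses: after
    exchanging the two indices of the Krawtchouk coefficients, the sum over l is
    ((1 + t)^3 + (1 - t)^3)^m = (2 + 6 t^2)^m. *)
Lemma duality (f : {poly R}) n m :
  \sum_(l < m.+1) 'C(m, l)%:R / 'C(3 * m, 3 * l)%:R
     * (even_enum f n (3 * m))`_(3 * l) =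
  2 ^+ m * \sum_(l < m.+1) 3 ^+ l * 'C(m, l)%:R / 'C(3 * m, 2 * l)%:R
     * split_coef f n (3 * m) (2 * l).
Proof.
set N := (3 * m)%N; pose c := split_coef f n N.
have bin0 a : (a <= N)%N -> 'C(N, a)%:R != 0 :> R.
  by move=> aN; rewrite pnatr_eq0 -lt0n bin_gt0.
transitivity (\sum_(a < N.+1) c a / 'C(N, a)%:R *
    (\sum_(l < m.+1) 'C(m, l)%:R *: krawtchouk N (3 * l))`_a).
  under eq_bigr do rewrite coef_sum mulr_sumr.
  rewrite exchange_big /=; apply: eq_bigr => a _.
  have aN : (a <= N)%N by rewrite -ltnS.
  rewrite coef_sum !mulr_sumr; apply: eq_bigr => l _.
  have lN : (3 * l <= N)%N by rewrite leq_mul2l /= -ltnS.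
  have := krawtchouk_sym aN lN; rewrite !coefZ => h.
  apply: (mulfI (bin0 _ aN)); apply: (mulfI (bin0 _ lN)).
  rewrite /c; set x := split_coef _ _ _ _.
  have -> : 'C(N, 3 * l)%:R * ('C(N, a)%:R * ('C(m, l)%:R / 'C(N, 3 * l)%:R *
     (x * (krawtchouk N a)`_(3 * l)))) =
     'C(m, l)%:R * x * ('C(N, a)%:R * (krawtchouk N a)`_(3 * l)).
    by field; rewrite bin0.
  by rewrite h; field; rewrite bin0.
have -> : \sum_(l < m.+1) 'C(m, l)%:R *: krawtchouk N (3 * l) =
   2 ^+ m *: \sum_(l < m.+1) (3 ^+ l * 'C(m, l)%:R) *: 'X^(2 * l).
  transitivity (((1 + 'X) ^+ 3 + (1 - 'X) ^+ 3 : {poly R}) ^+ m).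
    rewrite exprDn; apply: eq_bigr => l _.
    by rewrite /krawtchouk -!exprM mulnBr scaler_nat.
  rewrite (_ : _ + _ = 2%:P * (1 + 3%:P * 'X^2)); last by rewrite !polyC_natr; ring.
  rewrite exprMn -polyC_exp [LHS]mul_polyC; congr (_ *: _); rewrite exprDn.
  apply: eq_bigr => l _; rewrite expr1n mul1r exprMn -polyC_exp -exprM mul_polyC.
  by rewrite -scaler_nat scalerA mulrC.
under eq_bigr => a _.
  rewrite coefZ coef_sum mulrCA mulr_sumr.
  over.
rewrite -mulr_sumr; congr (_ * _); rewrite exchange_big /=; apply: eq_bigr => l _.
have lN : (2 * l < N.+1)%N by have := ltn_ord l; rewrite /N; lia.
rewrite (bigD1 (Ordinal lN)) //= big1 => [|a].
  by rewrite addr0 coefZ coefXn eqxx mulr1 /c; ring.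
by rewrite -val_eqE /= coefZ coefXn => /negPf ->; rewrite !mulr0.
Qed.
End Krawtchouk.

(** * Bounds for the weight enumerator *)

Section WeightBounds.
Variable R : realFieldType.

Lemma coef_tailser D k : (tailser R D)`_k = if (k < D)%N then ((k.+2)`!%:R)^-1 else 0.
Proof. exact: coef_poly. Qed.

Lemma logconc_tailser D : logconc (tailser R D).
Proof.
split=> [i|i j ij]; rewrite !coef_tailser; first by case: ifP => // _; rewrite invr_ge0.
case: (ltnP j.+1 D) => jD; last by rewrite mulr0 mulr_ge0 //; case: ifP => // _; rewrite invr_ge0.
rewrite !ifT; try lia.
rewrite -!invfM lef_pV2 ?posrE ?mulr_gt0 ?fact_gt0r // -!natrM ler_nat.
have E k : ((k.+3)`! = k.+3 * (k.+2)`!)%N by rewrite factS.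
rewrite (E i) (E j); move: (i.+2)`! (j.+2)`! => a b; by rewrite -mulnA [X in (_ <= X)%N]mulnCA leq_mul.
Qed.

Lemma blockser_ge0 D i : 0 <= (blockser R D)`_i.
Proof.
by have [h _] := logconc_tailser D; rewrite coefXnM; case: ifP.
Qed.

Lemma coef_X2M_exp (a : {poly R}) n N : (2 * n <= N)%N ->
  (('X^2 * a) ^+ n)`_N = (a ^+ n)`_(N - 2 * n).
Proof. by move=> nN; rewrite exprMn -exprM coefXnM_gap nN. Qed.

Lemma dilate_blockser (s : R) D :
  dilate s (blockser R D) = 'X^2 * (s ^+ 2 *: dilate s (tailser R D)).
Proof.
rewrite dilateM; have -> : dilate s ('X^2 : {poly R}) = s ^+ 2 *: 'X^2.
  by rewrite /dilate rmorphXn /= comp_polyX exprZn.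
by rewrite -scalerAl scalerAr.
Qed.

Lemma blockser_exp_gt0 D n N : (0 < n)%N -> (2 * n <= N)%N -> (N <= D)%N ->
  0 < (blockser R D ^+ n)`_N.
Proof.
move=> n0 nN ND; rewrite coef_X2M_exp //.
have : (N - 2 * n < D)%N by lia.
have -> : n = n.-1.+1 by rewrite prednK.
move: (N - _)%N => k kD {nN n0}; elim: (n.-1) k kD => [|h IH] k kD.
  by rewrite expr1 coef_tailser kD invr_gt0 fact_gt0r.
rewrite exprS coefM big_ord_recl subn0 ltr_pwDl //.
  by rewrite mulr_gt0 ?IH // coef_tailser ifT ?invr_gt0 ?fact_gt0r // (leq_ltn_trans _ kD).
have [t0 _] := logconc_tailser D; have [p0 _] := logconcX h.+1 (logconc_tailser D).
by apply: sumr_ge0 => i _; rewrite mulr_ge0.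
Qed.

Section Weights.
Variables (n N : nat).
Hypotheses (n_gt0 : (0 < n)%N) (nN : (2 * n <= N)%N).

Local Notation f := (blockser R N).
Local Notation U := ((f ^+ n)`_N).

(** Mean excess of a degree over its least value 2. *)
Definition excess : R := (N - 2 * n)%:R / n%:R.

Lemma excess_ge0 : 0 <= excess.
Proof. by rewrite divr_ge0. Qed.

Let U_gt0 : 0 < U. Proof. exact: blockser_exp_gt0. Qed.

Let mixture_bound (s alpha gamma : R) :
  0 <= s <= 1 -> 0 <= alpha -> 0 <= gamma ->
  (('X^2 * (alpha *: tailser R N + gamma *: dilate s (tailser R N))) ^+ n)`_N <=
  U * (alpha + gamma / (1 + excess * (1 - s))) ^+ n.
Proof.
move=> s01 al0 ga0; rewrite coef_X2M_exp // {1}/blockser coef_X2M_exp //.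
apply: negative_dependence => //; first exact: logconc_tailser.
by rewrite -coef_X2M_exp.
Qed.

Lemma weight_bound (s : R) : 0 <= s <= 1 ->
  ((dilate s f + f) ^+ n)`_N <= U * (1 + s ^+ 2 / (1 + excess * (1 - s))) ^+ n.
Proof.
move=> s01; rewrite dilate_blockser -mulrDr addrC -[X in _ * (X + _)]scale1r.
by apply: mixture_bound => //; rewrite exprn_ge0 //; case/andP: s01.
Qed.

Definition dominated (p q : {poly R}) := forall i, (i <= N)%N -> 0 <= p`_i <= q`_i.

Lemma dominatedM p q p' q' :
  dominated p q -> dominated p' q' -> dominated (p * p') (q * q').
Proof.
move=> d d' i iN; rewrite !coefM; apply/andP; split.
  apply: sumr_ge0 => j _; have jN : (j <= N)%N by rewrite (leq_trans _ iN) // -ltnS.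
  have /andP[h1 _] := d _ jN.
  have /andP[h2 _] := d' _ (leq_trans (leq_subr j i) iN).
  exact: mulr_ge0.
apply: ler_sum => j _; have jN : (j <= N)%N by rewrite (leq_trans _ iN) // -ltnS.
have /andP[? ?] := d _ jN.
have /andP[? ?] := d' _ (leq_trans (leq_subr j i) iN).
exact: ler_pM.
Qed.

Lemma dominatedX p q k : dominated p q -> dominated (p ^+ k) (q ^+ k).
Proof.
move=> d; elim: k => [|k IH]; last by rewrite !exprS; exact: dominatedM.
by move=> i _; rewrite !expr0 coef1 ler0n lexx.
Qed.

Lemma weight_norm (s : R) : - 1 <= s <= 1 ->
  ((dilate s f + f) ^+ n)`_N <= ((dilate `|s| f + f) ^+ n)`_N.
Proof.
rewrite -ler_norml => s1.
have /(_ N (leqnn N))/andP[//] : dominated ((dilate s f + f) ^+ n)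
   ((dilate `|s| f + f) ^+ n).
apply: dominatedX => i _; rewrite !coefD !coef_dilate -normrX.
have : `|s ^+ i| <= 1 by rewrite normrX exprn_ile1.
rewrite ler_norml => /andP[h _]; apply/andP; split.
  have -> : s ^+ i * f`_i + f`_i = (s ^+ i + 1) * f`_i by ring.
  by rewrite mulr_ge0 ?blockser_ge0 // -lerBlDr sub0r.
by rewrite lerD2r ler_wpM2r ?blockser_ge0 ?ler_norm.
Qed.

(** The products of two blocks, from the binomial theorem without its two
    first and two last terms. *)
Lemma coef_blockser_pair (e : R) k : (4 <= k)%N -> (k <= N)%N ->
  k`!%:R * (dilate e f * f)`_k =
  (1 + e) ^+ k - 1 - k%:R * e - k%:R * e ^+ k.-1 - e ^+ k.
Proof.
move=> k4 kN; rewrite exprDn.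
pose h j : R := 'C(k, j)%:R * e ^+ j.
pose g j : R := if (2 <= j)%N && (2 <= k - j)%N then h j else 0.
transitivity (\sum_(0 <= j < k.+1) g j).
  rewrite big_mkord coefM mulr_sumr; apply: eq_bigr => j _.
  have jk : (j <= k)%N by rewrite -ltnS.
  rewrite coef_dilate !coef_blockser; try lia.
  rewrite /g /h; case: (leqP 2 j) => j2; rewrite ?mulr0 ?mul0r ?mulr0 //=.
  case: (leqP 2 (k - j)) => kj2; rewrite ?mulr0 //= bin_fact_R //.
  by field; rewrite !fact_neq0.
have -> : \sum_(i < k.+1) 1 ^+ (k - i) * e ^+ i *+ 'C(k, i) =
          \sum_(0 <= j < k.+1) h j.
  rewrite big_mkord; apply: eq_bigr => j _.
  by rewrite expr1n mul1r /h mulr_natl.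
have split4 (u : nat -> R) : \sum_(0 <= j < k.+1) u j =
   u 0%N + u 1%N + \sum_(2 <= j < k.-1) u j + u k.-1 + u k.
  clear -k4; case: k k4 => [//|k k4] /=.
  rewrite big_ltn; last by lia.
  rewrite big_ltn; last by lia.
  rewrite big_nat_recr /=; last by lia.
  rewrite big_nat_recr /=; last by lia.
  by rewrite !addrA.
rewrite !split4 (eq_big_nat _ _ (F2 := h)); last first.
  by move=> j /andP[j2 jk]; rewrite /g j2 ifT //=; lia.
have -> : g 0%N = 0 by [].
have -> : g 1%N = 0 by [].
have -> : g k.-1 = 0.
  rewrite /g; have -> : (1 < k - k.-1)%N = false by lia.
  by rewrite andbF.
have -> : g k = 0 by rewrite /g subnn andbF.
rewrite /h bin0 bin1 binn expr0 expr1 !mul1r.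
have -> : 'C(k, k.-1) = k by case: (k) k4 => // k' _; rewrite binSn.
by rewrite !add0r !addr0; ring.
Qed.

Lemma exp2_ge k : (5 <= k)%N -> 7 * k%:R - 3 <= 2 ^+ k :> R.
Proof.
move=> k5; have [j ->] : exists j, k = (5 + j)%N by exists (k - 5)%N; rewrite subnKC.
elim: j {k5} => [|j IH]; first by rewrite addn0; lra.
by rewrite addnS exprS -natr1; have : 0 <= j%:R :> R; [by [] | move: IH; rewrite natrD; lra].
Qed.

(** Weight of a degree when odd degrees are charged 1/2: a bound, for s in
    [-1, 0], of the average of f(z) and f(s z). *)
Local Notation half_odd := (4^-1 *: (3 *: f + dilate (- 1) f)).

(** Weight of a degree when degrees above 2 are charged 9/10. *)
Local Notation discount := (20^-1 *: (18 *: f + 'X^2)).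

(** An even number other than 4 = 2 + 2 has comparable total weights of
    decompositions into two odd degrees and into two even degrees. Hence a
    charge on odd degrees can be replaced, two variables at a time, by a charge
    on the degrees above 2, which unlike parity is monotone in the degree. *)
Lemma half_odd_sqr : dominated (half_odd ^+ 2) (discount ^+ 2).
Proof.
move=> k kN; have f0 := blockser_ge0 N.
pose F := (f * f)`_k; pose G := (dilate (- 1) f * f)`_k; pose e : R := (- 1) ^+ k.
have coefL : (half_odd ^+ 2)`_k = (9 * F + 6 * G + e * F) / 16.
  have -> : half_odd ^+ 2 = 16^-1 *: (9 *: (f * f) + 6 *: (dilate (- 1) f * f)
      + dilate (- 1) (f * f)).
    rewrite exprZn [dilate _ (f * f)]dilateM; congr (_ *: _); first by field.
    by rewrite !scaler_nat; ring.
  by rewrite coefZ !coefD !coefZ coef_dilate -/F -/G -/e mulrC.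
have coefR : (discount ^+ 2)`_k =
    (324 * F + 36 * (f * 'X^2)`_k + ('X^4 : {poly R})`_k) / 400.
  have -> : discount ^+ 2 = 400^-1 *: (324 *: (f * f) + 36 *: (f * 'X^2) + 'X^4).
    rewrite exprZn; congr (_ *: _); first by field.
    by rewrite !scaler_nat; ring.
  by rewrite coefZ !coefD !coefZ mulrC.
have fX0 : 0 <= (f * 'X^2)`_k by rewrite coefMXn; case: ifP.
have X40 : 0 <= ('X^4 : {poly R})`_k by rewrite coefXn ler0n.
have e1 : e = 1 \/ e = - 1.
  by rewrite /e -signr_odd; case: odd; [right | left]; rewrite ?expr1 ?expr0.
rewrite coefL coefR; case: (ltnP k 4) => k4.
  have small (a : {poly R}) : ('X^2 * a * f)`_k = 0.
    rewrite /blockser mulrAC mulrA -mulrA -exprD coefXnM_gap ifF //.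
    by apply/negbTE; rewrite -ltnNge.
  have -> : F = 0 by rewrite /F {1}/blockser small.
  have -> : G = 0 by rewrite /G dilate_blockser small.
  by apply/andP; split; lra.
have hF := coef_blockser_pair 1 k4 kN.
have hG := coef_blockser_pair (- 1) k4 kN.
rewrite dilate1 -/F !expr1n in hF; rewrite -/G -/e in hG.
have ee : (- 1) ^+ k.-1 = - e.
  by rewrite /e -[in RHS](prednK (leq_trans (isT : 0 < 4)%N k4)) exprS; ring.
rewrite ee subrr expr0n gtn_eqF ?(leq_trans _ k4) // in hG.
have kf := fact_gt0r R k.
move: k4; rewrite leq_eqVlt => /predU1P[k4|k5].
  have fX : (f * 'X^2)`_4 = 1 / 2.
    by rewrite coefMXn coef_blockser ?div1r //; lia.
  rewrite -k4 coefXn eqxx fX; move: hF hG.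
  rewrite /e -k4 (_ : 4`! = 24)%N // !exprS expr0 => hF hG.
  rewrite /= mulr0n in hG; have {hF} hF' : 24 * F = 6 by rewrite hF; ring.
  have {hG} hG' : 24 * G = 6 by rewrite hG; ring.
  have n24 : 24 != 0 :> R by rewrite pnatr_eq0.
  have -> : F = 1 / 4 by apply: (mulfI n24); rewrite hF'; field.
  have -> : G = 1 / 4 by apply: (mulfI n24); rewrite hG'; field.
  by rewrite !expr0 /=; apply/andP; split; lra.
have h2 : 7 * k%:R - 3 <= (1 + 1) ^+ k :> R := exp2_ge k5.
move: h2 hF; move: ((1 + 1) ^+ k) => p h2 hF.
have kr5 : 5 <= k%:R :> R by rewrite ler_nat.
have F0 : 0 <= F by rewrite -(pmulr_rge0 _ kf) hF; lra.
rewrite /= mulr0n in hG.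
have G0 : 0 <= G by rewrite -(pmulr_rge0 _ kf) hG; case: e1 => ->; lra.
have GF : 6 * G <= 296 / 100 * F.
  rewrite -(ler_pM2l kf) mulrCA [X in _ <= X]mulrCA hF hG.
  by case: e1 => ->; lra.
by apply/andP; split; case: e1 => ->; lra.
Qed.

Lemma half_odd_le : dominated half_odd (10 / 9 *: discount).
Proof.
move=> i iN; rewrite !coefZ !coefD !coefZ coef_dilate.
have f0 := blockser_ge0 N i; have X0 : 0 <= ('X^2 : {poly R})`_i by rewrite coefXn ler0n.
rewrite -signr_odd; case: odd; rewrite ?expr1 ?expr0; apply/andP; split; lra.
Qed.

Lemma weight_half_odd (s : R) : - 1 <= s <= 0 ->
  dominated (2^-1 *: (dilate s f + f)) half_odd.
Proof.
move=> /andP[s1 s0] i iN; rewrite !coefZ !coefD !coefZ !coef_dilate.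
have f0 := blockser_ge0 N i.
have ns1 : 0 <= - s <= 1 by apply/andP; split; lra.
have /andP[t0 t1] : 0 <= (- s) ^+ i <= 1.
  by case/andP: ns1 => ? ?; rewrite exprn_ge0 // exprn_ile1.
have -> : s ^+ i = (- 1) ^+ i * (- s) ^+ i by rewrite -exprMn mulN1r opprK.
rewrite -signr_odd; move: t0 t1; move: ((- s) ^+ i) => t t0 t1.
by case: odd; rewrite ?expr1 ?expr0; apply/andP; split; nra.
Qed.

(** Near s = -1 the bound through |s| is trivial, since all degrees could be
    even; but then many degrees would exceed 2, and a degree that exceeds 2 can
    as well be odd. *)
Lemma weight_neg_bound (s : R) : - 1 <= s <= 0 -> excess <= 1 ->
  ((dilate s f + f) ^+ n)`_N <= 10 / 9 * (2 ^+ n * U) * (1 - excess / 20) ^+ n.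
Proof.
move=> s01 ex1; have ex0 := excess_ge0.
have dh : dominated (half_odd ^+ n) (10 / 9 *: discount ^+ n).
  have d2 := dominatedX n./2 half_odd_sqr.
  rewrite -(odd_double_half n) exprD -mul2n exprM.
  have -> : 10 / 9 *: discount ^+ (odd n + 2 * n./2) =
      (10 / 9 *: discount ^+ odd n) * (discount ^+ 2) ^+ n./2.
    by rewrite exprD exprM scalerAl.
  apply: dominatedM d2; case: odd; rewrite ?expr1; first exact: half_odd_le.
  move=> i iN; rewrite coefZ !expr0 coef1 ler0n /=.
  by have : 0 <= (i == 0%N)%:R :> R; [exact: ler0n | lra].
have := dominatedX n (weight_half_odd s01) (leqnn N) => /andP[_ h1].
have /andP[_ h2] := dh _ (leqnn N).
have h3 : (discount ^+ n)`_N <= U * (1 - excess / 20) ^+ n.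
  (* The dilation by 0 keeps the degree 2 only. *)
  have -> : discount = 'X^2 * ((9 / 10) *: tailser R N +
      (1 / 10) *: dilate 0 (tailser R N)).
    have -> : dilate 0 (tailser R N) = (1 / 2)%:P.
      apply/polyP=> -[|i]; rewrite coef_dilate coefC /=; last by rewrite exprS !mul0r.
      by rewrite coef_tailser ifT ?expr0 ?mul1r ?div1r //; lia.
    apply/polyP=> i; rewrite coefXnM coefZ coefD coefZ coefXnM coefXn.
    case: ltnP => i2; first by rewrite ltn_eqF //=; ring.
    rewrite coefD !coefZ coefC subn_eq0 [(i == 2)%N]eqn_leq i2 andbT.
    by case: leqP => _ /=; field.
  have z01 : 0 <= (0 : R) <= 1 by rewrite lexx ler01.
  have c1 : 0 <= 9 / 10 :> R by lra.
  have c2 : 0 <= 1 / 10 :> R by lra.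
  apply: (le_trans (@mixture_bound 0 _ _ z01 c1 c2)).
  rewrite ler_pM2l // subr0 mulr1; apply: lerXn2r; rewrite ?nnegrE.
  - by rewrite addr_ge0 // divr_ge0 // addr_ge0.
  - lra.
  - have : 1 / 10 / (1 + excess) <= 1 / 10 - excess / 20.
      by rewrite ler_pdivrMr; nra.
    by lra.
rewrite exprZn coefZ exprVn ler_pdivrMl ?exprn_gt0 // in h1.
apply: (le_trans h1).
have -> : 10 / 9 * (2 ^+ n * U) * (1 - excess / 20) ^+ n =
  2 ^+ n * (10 / 9 * (U * (1 - excess / 20) ^+ n)) by ring.
rewrite ler_pM2l ?exprn_gt0 //; rewrite coefZ in h2.
by apply: (le_trans h2); rewrite ler_pM2l; [exact: h3 | lra].
Qed.
End Weights.
End WeightBounds.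

From mathcomp Require Import all_classical all_reals all_analysis.

Import numFieldNormedType.Exports.

Local Open Scope classical_set_scope.

(** * Elementary inequalities *)

Section Binomials.

Lemma bin_mul_le a b i j : ('C(a, i) * 'C(b, j) <= 'C(a + b, i + j))%N.
Proof.
rewrite -binomial.Vandermonde; have ij : (i < (i + j).+1)%N by rewrite ltnS leq_addr.
by rewrite (bigD1 (Ordinal ij)) //= addKn leq_addr.
Qed.

Lemma bin_cube_le m l : ('C(m, l) ^ 3 <= 'C(3 * m, 3 * l))%N.
Proof.
rewrite !mulSn mul0n !addn0 !expnS expn0 muln1.
by rewrite (leq_trans _ (bin_mul_le _ _ _ _)) // leq_mul2l bin_mul_le orbT.
Qed.

Lemma exp_le_bin m l : (l <= m)%N -> (m ^ l <= 'C(m, l) * l ^ l)%N.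
Proof.
elim: l m => [|l IH] [|m] // lm; rewrite ?bin0 //.
rewrite !expnS mulnA [('C(_, _) * _)%N]mulnC -mul_bin_diag -mulnA.
rewrite leq_mul2l /=; case: l IH lm => [|l] IH lm; first by rewrite bin0.
have h : (m.+1 * l.+1 <= m * l.+2)%N by rewrite mulSn mulnS; lia.
have := leq_exp2r (m.+1 * l.+1) (m * l.+2) (ltn0Sn l); rewrite h !expnMn => h1.
rewrite -(@leq_pmul2r (l.+1 ^ l.+1)) ?expn_gt0 // (leq_trans h1) //.
by rewrite mulnAC leq_mul2r IH ?orbT.
Qed.

(** The mode of the binomial law with m trials and mean l is l, so that l has
    probability at least 1 / (m + 1). *)
Lemma exp_le_mode m l : (l <= m)%N ->
  (m ^ m <= m.+1 * ('C(m, l) * l ^ l * (m - l) ^ (m - l)))%N.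
Proof.
move=> lm; pose t k := ('C(m, k) * l ^ k * (m - l) ^ (m - k))%N.
have step k : (k < m)%N ->
    (t k.+1 * (k.+1 * (m - l)) = t k * ((m - k) * l))%N.
  move=> km; rewrite /t -(subnSK km) !expnS.
  have := mul_bin_left m k; rewrite -(subnSK km) => h.
  transitivity ((k.+1 * 'C(m, k.+1)) * (l * l ^ k) * (m - l) ^ (m - k.+1) * (m - l))%N.
    by ring.
  by rewrite h; ring.
have [->|ltlm] := eqVneq l m; first by rewrite binn subnn expn0 mul1n muln1 leq_pmull.
have {}ltlm : (l < m)%N by rewrite ltn_neqAle ltlm.
have up k : (k < l)%N -> (t k <= t k.+1)%N.
  move=> kl; have pos : (0 < k.+1 * (m - l))%N by rewrite muln_gt0 subn_gt0.
  rewrite -(leq_pmul2r pos) step ?(ltn_trans kl) // leq_mul2l; apply/orP; right.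
  by rewrite mulnC leq_mul // leq_sub2l // ltnW.
have down k : (l <= k)%N -> (k < m)%N -> (t k.+1 <= t k)%N.
  move=> lk km; have pos : (0 < k.+1 * (m - l))%N by rewrite muln_gt0 subn_gt0.
  rewrite -(leq_pmul2r pos) step // leq_mul2l; apply/orP; right.
  by rewrite mulnC leq_mul // ?leq_sub2l // (leq_trans lk).
have mode k : (k <= m)%N -> (t k <= t l)%N.
  move=> km; have [lk|kl] := leqP l k.
    move: km; rewrite -(subnKC lk); elim: (k - l)%N => [|d IH]; first by rewrite addn0.
    rewrite addnS => h; apply: leq_trans (IH (ltnW h)).
    by rewrite down // leq_addr.
  rewrite -(subKn (ltnW kl)); move: (leq_subr k l); elim: (l - k)%N => [|d IH]; first by rewrite subn0.
  move=> h; apply: leq_trans (IH (ltnW h)).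
  by rewrite -(subnSK h) up // subnSK // leq_subr.
have -> : (m ^ m = \sum_(k < m.+1) t k)%N.
  rewrite -{1}(subnK lm) expnDn; apply: eq_bigr => k _.
  by rewrite /t mulnAC mulnA.
rewrite -[X in (_ <= X * _)%N]card_ord -sum_nat_const; apply: leq_sum => k _.
by apply: mode; rewrite -ltnS.
Qed.
End Binomials.

Section RealInequalities.
Variable R : realType.
Implicit Types a b c s w x y : R.

(** The inequality between weighted arithmetic and geometric means, from
    x <= exp (x - 1). *)
Lemma exp_weighted_le1 (p q : nat) a b : 0 <= a -> 0 <= b ->
  p%:R * a + q%:R * b <= p%:R + q%:R -> a ^+ p * b ^+ q <= 1.
Proof.
move=> a0 b0 h.
have le_exp c k : 0 <= c -> c ^+ k <= expR ((c - 1) * k%:R).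
  move=> c0; rewrite expRM_natr; apply: lerXn2r; rewrite ?nnegrE ?expR_ge0 //.
  by rewrite -[X in X <= _](subrKC 1); exact: expR_ge1Dx.
rewrite (le_trans (ler_pM _ _ (le_exp a p a0) (le_exp b q b0))) ?exprn_ge0 //.
rewrite -expRD -[X in _ <= X]expR0 ler_expR.
have -> : (a - 1) * p%:R + (b - 1) * q%:R =
  (p%:R * a + q%:R * b) - (p%:R + q%:R) by ring.
by rewrite subr_le0.
Qed.

(** The function t |-> 1 + a / (1 + t x) is log-convex; here it is interpolated
    between t = 0 and t = 1 at t = q / (p + q). *)
Lemma logconvex_interpolation (p q : nat) a x : (0 < p + q)%N -> 0 <= a -> 0 <= x ->
  (1 + a / (1 + q%:R / (p + q)%:R * x)) ^+ (p + q) <=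
  (1 + a) ^+ p * (1 + a / (1 + x)) ^+ q.
Proof.
move=> pq a0 x0; set n := (p + q)%N; set th : R := q%:R / n%:R.
have n0 : 0 < n%:R :> R by rewrite ltr0n.
have th0 : 0 <= th by rewrite divr_ge0.
have th1 : th <= 1 by rewrite ler_pdivrMr // mul1r ler_nat leq_addl.
have thx : 0 <= th * x by rewrite mulr_ge0.
have qE : q%:R = n%:R * th by rewrite mulrC divfK ?gt_eqF.
have pE : p%:R = n%:R * (1 - th) :> R.
  by rewrite mulrBr -qE mulr1 /n natrD addrK.
clearbody th; set B := 1 + th * x; set A := 1 + a + th * x.
have B0 : 0 < B by rewrite ltr_pwDl.
have A0 : 0 < A by rewrite /A; lra.
pose r0 := B^-1 * A / (1 + a); pose r1 := (1 + x) / B * A / (1 + a + x).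
have a1 : 0 < 1 + a by lra.
have x1 : 0 < 1 + x by lra.
have ax1 : 0 < 1 + a + x by lra.
have nz : (B != 0) * (A != 0) * (1 + a != 0) * (1 + x != 0) * (1 + a + x != 0).
  by rewrite !gt_eqF.
have -> : (1 + a / B) ^+ n = (r0 ^+ p * r1 ^+ q) * ((1 + a) ^+ p * (1 + a / (1 + x)) ^+ q).
  rewrite mulrACA -!exprMn /n exprD; congr (_ ^+ p * _ ^+ q).
    by rewrite /r0 /A -/B; move: nz; rewrite /A /B; set z := th * x => nz; field; rewrite !nz.
  rewrite /r1; move: nz; rewrite /A /B; set z := th * x => nz; field; rewrite !nz.
  done.
apply: ler_piMl.
  by rewrite mulr_ge0 ?exprn_ge0 ?addr_ge0 ?divr_ge0 ?(ltW x1).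
apply: exp_weighted_le1.
- by rewrite /r0 !mulr_ge0 ?invr_ge0 ?ltW.
- by rewrite /r1 !mulr_ge0 ?invr_ge0 ?ltW.
rewrite pE qE (_ : _ + _ * r1 = n%:R * ((1 - th) * r0 + th * r1)); last by ring.
rewrite [X in _ <= X](_ : _ = n%:R * 1); last by ring.
rewrite ler_pM2l //.
have -> : (1 - th) * r0 + th * r1 =
   A * ((1 - th) * (1 + a + x) + th * (1 + x) * (1 + a)) / (B * (1 + a) * (1 + a + x)).
  rewrite /r0 /r1; move: (nz); set z := A; set z' := B => nz'; field; rewrite !nz'; done.
rewrite ler_pdivrMr ?mulr_gt0 // mul1r -subr_ge0.
have -> : B * (1 + a) * (1 + a + x) -
  A * ((1 - th) * (1 + a + x) + th * (1 + x) * (1 + a)) =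
  a * th * (1 - th) * x ^+ 2 by rewrite /A /B; ring.
by rewrite !mulr_ge0 ?exprn_ge0 // subr_ge0.
Qed.

(** For w = 2 sqrt(u v) and u + v = 1, this is (u^(3/2) + v^(3/2))^2. *)
Definition profile w : R := (4 - 3 * w ^+ 2 + w ^+ 3) / 4.

Lemma profile_ge w : 0 <= w <= 1 -> 2^-1 <= profile w.
Proof.
move=> /andP[w0 w1].
have h : 0 <= (1 - w) * (2 + 2 * w - w ^+ 2) by rewrite mulr_ge0 //; nra.
rewrite -subr_ge0 (_ : _ - _ = (1 - w) * (2 + 2 * w - w ^+ 2) / 4); first by lra.
by rewrite /profile; field.
Qed.

(** The case of mean excess 0, that is m / n = 2 / 3. *)
Lemma profile_excess0 s w : 0 <= w <= 1 -> s ^+ 2 + w ^+ 2 = 1 ->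
  ((1 + s ^+ 2) / 2) ^+ 3 <= profile w ^+ 2 * (1 - w ^+ 3 / 8).
Proof.
move=> /andP[w0 w1] sw; have -> : s ^+ 2 = 1 - w ^+ 2 by lra.
have w30 : 0 <= w ^+ 3 by rewrite exprn_ge0.
set B := 4 - 3 * w ^+ 2 + w ^+ 3.
have B16 : B ^+ 2 <= 16.
  have B0 : 0 <= B by rewrite /B; nra.
  have B4 : B <= 4 by rewrite /B; nra.
  by nra.
have c2 : 2 <= 8 - 3 * w - 6 * w ^+ 2 + 3 * w ^+ 3 by nra.
have key : profile w ^+ 2 * (1 - w ^+ 3 / 8) - ((1 + (1 - w ^+ 2)) / 2) ^+ 3 =
  16^-1 * (w ^+ 3 * ((8 - 3 * w - 6 * w ^+ 2 + 3 * w ^+ 3) - B ^+ 2 / 8)).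
  by rewrite /profile /B; field.
by rewrite -subr_ge0 key !mulr_ge0 // subr_ge0; lra.
Qed.

(** The case of mean excess 1, that is m / n = 1: there is equality at s = 0,
    which corresponds to the sets of m / 2 clauses. *)
Lemma profile_excess1 s w : 0 <= s -> 0 <= w <= 1 -> s ^+ 2 + w ^+ 2 = 1 ->
  (1 + s ^+ 2 / (1 + (1 - s))) / 2 <= profile w.
Proof.
move=> s0 /andP[w0 w1] sw.
have s1 : s <= 1 by nra.
have sle : s <= 1 - w ^+ 2 / 2 by nra.
have -> : s ^+ 2 = (1 - w) * (1 + w) by lra.
rewrite ler_pdivrMr // -lerBrDl ler_pdivrMr; last by lra.
have -> : profile w * 2 - 1 = (1 - w) * ((2 + 2 * w - w ^+ 2) / 2).
  by rewrite /profile; field.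
rewrite -mulrA; apply: ler_wpM2l; first by lra.
have h : 1 + w ^+ 2 / 2 <= 1 + (1 - s) by lra.
have c0 : 0 <= (2 + 2 * w - w ^+ 2) / 2 by nra.
apply: le_trans (ler_wpM2l c0 h).
by nra.
Qed.
End RealInequalities.

(** * Expected number of even sets of clauses of a given size *)

Section EvenSets.
Variables (R : realType) (m n : nat).
Hypotheses (m_gt0 : (0 < m)%N) (mn : (m <= n)%N) (nm : (2 * n <= 3 * m)%N).

Local Notation N := (3 * m)%N.
Local Notation f := (blockser R N).
Local Notation U := ((f ^+ n)`_N).
Local Notation th := (excess R n N).

(** Expected number of the sets of l clauses which meet every variable an even
    number of times, among m clauses and n variables of degree at least 2. *)
Definition even_sets l : R :=
  'C(m, l)%:R / 'C(N, 3 * l)%:R * ((even_enum f n N)`_(3 * l) / (2 ^+ n * U)).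

(** Expectation of the product of the (1 + s^d) / 2 over the degrees d. *)
Definition mean_weight (s : R) : R := ((dilate s f + f) ^+ n)`_N / (2 ^+ n * U).

Let n_gt0 : (0 < n)%N. Proof. exact: leq_trans m_gt0 mn. Qed.
Let nr_gt0 : 0 < n%:R :> R. Proof. by rewrite ltr0n. Qed.
Let mr_gt0 : 0 < m%:R :> R. Proof. by rewrite ltr0n. Qed.

Let U_gt0 : 0 < U. Proof. exact: blockser_exp_gt0. Qed.

Let pU_gt0 : 0 < 2 ^+ n * U. Proof. by rewrite mulr_gt0 ?exprn_gt0. Qed.

Lemma excess_nat : th * n%:R = (3 * m - 2 * n)%:R.
Proof. by rewrite divfK ?gt_eqF. Qed.

Lemma excessE : th * n%:R = 3 * m%:R - 2 * n%:R.
Proof. by rewrite excess_nat natrB // !natrM. Qed.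

Let th_ge0 : 0 <= th. Proof. exact: excess_ge0. Qed.
Let th_le1 : th <= 1.
Proof. by rewrite -(ler_pM2r nr_gt0) excess_nat mul1r ler_nat; lia. Qed.

Lemma even_sets_ge0 l : 0 <= even_sets l.
Proof.
rewrite /even_sets !mulr_ge0 ?invr_ge0 ?(ltW pU_gt0) //.
by apply: even_enum_ge0 => i; exact: blockser_ge0.
Qed.

Lemma even_sets0 : even_sets 0 = 1.
Proof.
rewrite /even_sets !muln0 !bin0 even_enum0 (divff (lt0r_neq0 pU_gt0)) mulr1 divff ?oner_neq0 //.
Qed.

Lemma bin_ratio_le l : (l <= m)%N ->
  'C(m, l)%:R / 'C(N, 3 * l)%:R <= 'C(m, l)%:R ^- 2 :> R.
Proof.
move=> lm; have b0 : 0 < 'C(m, l)%:R :> R by rewrite ltr0n bin_gt0.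
have c0 : 0 < 'C(N, 3 * l)%:R :> R by rewrite ltr0n bin_gt0 leq_mul2l.
rewrite ler_pdivrMr // mulrC ler_pdivlMr ?exprn_gt0 // -exprS -natrX ler_nat.
exact: bin_cube_le.
Qed.

Lemma even_sets_chernoff (u v : R) l : 0 < u -> 0 < v -> u + v = 1 -> (l <= m)%N ->
  even_sets l <= 'C(m, l)%:R ^- 2 * mean_weight (v - u) /
                 (u ^+ (3 * l) * v ^+ (3 * (m - l))).
Proof.
move=> u0 v0 uv lm; have lN : (3 * l <= N)%N by rewrite leq_mul2l lm.
have uv0 : 0 < u ^+ (3 * l) * v ^+ (3 * (m - l)) by rewrite mulr_gt0 ?exprn_gt0.
have h := even_enum_chernoff n (blockser_ge0 R N) u0 v0 uv lN.
rewrite ler_pdivlMr // /even_sets /mean_weight -[X in X <= _]mulrA.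
apply: ler_pM; last 1 first.
- rewrite mulrAC ler_pM2r ?invr_gt0 //; move: h; rewrite -mulnBr.
  exact.
- by rewrite divr_ge0.
- rewrite mulr_ge0 ?(ltW uv0) // divr_ge0 ?(ltW pU_gt0) //.
  by apply: even_enum_ge0 => i; exact: blockser_ge0.
- exact: bin_ratio_le.
Qed.

Lemma mean_weight_le (s : R) : - 1 <= s <= 1 ->
  mean_weight s <= ((1 + `|s| ^+ 2 / (1 + th * (1 - `|s|))) / 2) ^+ n.
Proof.
move=> s1; rewrite /mean_weight ler_pdivrMr // expr_div_n.
have := weight_norm n N s1 => /le_trans; apply.
have s01 : 0 <= `|s| <= 1 by rewrite normr_ge0 ler_norml.
apply: (le_trans (weight_bound n_gt0 nm s01)).
by rewrite mulrA divfK ?expf_neq0 // mulrC.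
Qed.

Lemma mean_weight_neg (s : R) : - 1 <= s <= 0 ->
  mean_weight s <= 10 / 9 * (1 - th / 20) ^+ n.
Proof.
move=> s1; rewrite /mean_weight ler_pdivrMr //.
apply: (le_trans (weight_neg_bound n_gt0 nm s1 th_le1)).
by rewrite le_eqVlt; apply/orP; left; apply/eqP; ring.
Qed.

(** ** Sets of intermediate size *)

(** Here u and v are in the proportion of l^(2/3) and (m - l)^(2/3), so that
    for these u and v the Chernoff bound is least at the size considered. *)
Lemma even_sets_middle l : (0 < l < m)%N ->
  even_sets l <= m.+1%:R ^+ 2 *
    expR (- ((n - m)%:R * (l%:R * (m - l)%:R) / (2 * m%:R ^+ 2))).
Proof.
have pq_n : (3 * (n - m) + (3 * m - 2 * n) = n)%N by lia.
have pq_m : (2 * (n - m) + (3 * m - 2 * n) = m)%N by lia.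
move=> /andP[l0 lm]; have l0r : 0 < l%:R :> R by rewrite ltr0n.
have k0r : 0 < (m - l)%:R :> R by rewrite ltr0n subn_gt0.
pose x : R := l%:R `^ 3^-1; pose y : R := (m - l)%:R `^ 3^-1.
have x0 : 0 < x by rewrite powR_gt0.
have y0 : 0 < y by rewrite powR_gt0.
have x3 : x ^+ 3 = l%:R by rewrite -powR_mulrn ?(ltW x0) // -powRrM mulVf ?powRr1 // ltW.
have y3 : y ^+ 3 = (m - l)%:R.
  by rewrite -powR_mulrn ?(ltW y0) // -powRrM mulVf ?powRr1 // ltW.
pose d := x ^+ 2 + y ^+ 2; have d0 : 0 < d by rewrite addr_gt0 ?exprn_gt0.
pose u := x ^+ 2 / d; pose v := y ^+ 2 / d; pose w := 2 * x * y / d.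
have u0 : 0 < u by rewrite divr_gt0 ?exprn_gt0.
have v0 : 0 < v by rewrite divr_gt0 ?exprn_gt0.
have uv : u + v = 1 by rewrite /u /v -mulrDl divff ?gt_eqF.
have sw : `|v - u| ^+ 2 + w ^+ 2 = 1.
  rewrite real_normK ?num_real // /u /v /w /d; field.
  by rewrite gt_eqF.
have w01 : 0 <= w <= 1.
  rewrite divr_ge0 ?mulr_ge0 ?(ltW x0) ?(ltW y0) ?(ltW d0) //= ler_pdivrMr // mul1r /d.
  by have := sqr_ge0 (x - y); nra.
have mE : m%:R = x ^+ 3 + y ^+ 3 by rewrite x3 y3 -natrD subnKC // ltnW.
have pE : profile w = m%:R ^+ 2 / d ^+ 3.
  by rewrite mE /profile /w /d; field; rewrite gt_eqF.
have s1 : - 1 <= v - u <= 1 by apply/andP; split; lra.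
have p0 : 0 <= profile w by have := profile_ge w01; lra.
have w3 : 0 <= 1 - w ^+ 3 / 8.
  have /andP[wa wb] := w01; have := exprn_ile1 3 wa wb; lra.
have weight : mean_weight (v - u) <= profile w ^+ m * (1 - w ^+ 3 / 8) ^+ (n - m).
  apply: (le_trans (mean_weight_le s1)); rewrite expr_div_n.
  set s := `|v - u| in sw *; have s0 : 0 <= s by exact: normr_ge0.
  have s_le1 : s <= 1 by rewrite ler_norml.
  (* The weights of the interpolation are 1 - th = 3 (n - m) / n and
     th = (3 m - 2 n) / n, so that all exponents are integers. *)
  have := @logconvex_interpolation R (3 * (n - m)) (3 * m - 2 * n) (s ^+ 2) (1 - s).
  rewrite pq_n -/(excess R n N) subr_ge0 => /(_ n_gt0 (exprn_ge0 _ s0) s_le1) h.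
  rewrite ler_pdivrMr ?exprn_gt0 //; apply: (le_trans h).
  have e0 := profile_excess0 w01 sw; have e1 := profile_excess1 s0 w01 sw.
  have e0' : (1 + s ^+ 2) ^+ 3 <= 2 ^+ 3 * (profile w ^+ 2 * (1 - w ^+ 3 / 8)).
    by move: e0; rewrite expr_div_n ler_pdivrMr ?exprn_gt0 // [X in _ <= X]mulrC.
  have e1' : 1 + s ^+ 2 / (1 + (1 - s)) <= 2 * profile w.
    by move: e1; rewrite ler_pdivrMr // [X in _ <= X]mulrC.
  have a0 : 0 <= (1 + s ^+ 2) ^+ 3 by rewrite exprn_ge0 // addr_ge0 // exprn_ge0.
  have b0 : 0 <= 1 + s ^+ 2 / (1 + (1 - s)).
    by rewrite addr_ge0 // divr_ge0 ?exprn_ge0 // addr_ge0 // subr_ge0.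
  have regroup (P z : R) (j k : nat) : P ^+ (2 * j + k) * z ^+ j * 2 ^+ (3 * j + k) =
      (2 ^+ 3 * (P ^+ 2 * z)) ^+ j * (2 * P) ^+ k.
    rewrite (exprD P) (exprD 2) !exprM; move: (2 ^+ 3) (P ^+ 2) => A B.
    by rewrite !exprMn; ring.
  have := regroup (profile w) (1 - w ^+ 3 / 8) (n - m)%N (3 * m - 2 * n)%N.
  rewrite pq_m pq_n => ->.
  rewrite exprM; apply: ler_pM; [exact: exprn_ge0 | exact: exprn_ge0 | |].
    by apply: lerXn2r; rewrite ?nnegrE // (le_trans a0).
  by apply: lerXn2r; rewrite ?nnegrE // (le_trans b0).
apply: (le_trans (even_sets_chernoff u0 v0 uv (ltnW lm))).
have b0 : 0 < 'C(m, l)%:R :> R by rewrite ltr0n bin_gt0 ltnW.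
have uvE : u ^+ (3 * l) * v ^+ (3 * (m - l)) =
    (l%:R ^+ l * (m - l)%:R ^+ (m - l)) ^+ 2 / d ^+ (3 * m).
  have -> : d ^+ (3 * m) = d ^+ (3 * l) * d ^+ (3 * (m - l)).
    by rewrite -exprD -mulnDr subnKC // ltnW.
  rewrite /u /v !expr_div_n -x3 -y3 -!(exprM _ 3) ![_ ^+ 2 ^+ _]exprAC.
  move: (x ^+ _) (y ^+ (3 * _)) => X Y.
  by field; rewrite !expf_neq0 // gt_eqF.
set E := l%:R ^+ l * (m - l)%:R ^+ (m - l) in uvE.
have E0 : 0 < E by rewrite mulr_gt0 ?exprn_gt0.
have mode : m%:R ^+ m <= m.+1%:R * ('C(m, l)%:R * E).
  have -> : 'C(m, l)%:R * E = ('C(m, l) * l ^ l * (m - l) ^ (m - l))%:R.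
    by rewrite 2!natrM !natrX /E mulrA.
  by rewrite -natrM -natrX ler_nat exp_le_mode // ltnW.
have -> : ('C(m, l)%:R ^- 2 * mean_weight (v - u) / (u ^+ (3 * l) * v ^+ (3 * (m - l)))) =
    mean_weight (v - u) * (d ^+ (3 * m) / ('C(m, l)%:R * E) ^+ 2).
  rewrite uvE; field; rewrite !gt_eqF ?exprn_gt0 //.
have c0 : 0 <= d ^+ (3 * m) / ('C(m, l)%:R * E) ^+ 2.
  by rewrite divr_ge0 ?exprn_ge0 ?mulr_ge0 ?(ltW d0) ?(ltW b0) ?(ltW E0).
apply: (le_trans (ler_wpM2r c0 weight)).
have -> : profile w ^+ m * (1 - w ^+ 3 / 8) ^+ (n - m) * (d ^+ (3 * m) / ('C(m, l)%:R * E) ^+ 2) =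
   (m%:R ^+ m / ('C(m, l)%:R * E)) ^+ 2 * (1 - w ^+ 3 / 8) ^+ (n - m).
  rewrite pE !expr_div_n -!exprM [(2 * m)%N]mulnC; field.
  by rewrite !gt_eqF ?exprn_gt0.
have bE : 0 < 'C(m, l)%:R * E by rewrite mulr_gt0.
apply: ler_pM.
- by rewrite exprn_ge0 // divr_ge0 ?exprn_ge0 ?(ltW bE) ?(ltW mr_gt0).
- by rewrite exprn_ge0.
- apply: lerXn2r; rewrite ?nnegrE ?divr_ge0 ?exprn_ge0 ?(ltW bE) ?(ltW mr_gt0) //.
  by rewrite ler_pdivrMr.
have -> : (n - m)%:R * (l%:R * (m - l)%:R) / (2 * m%:R ^+ 2) =
   (l%:R * (m - l)%:R / (2 * m%:R ^+ 2)) * (n - m)%:R :> R by field; rewrite gt_eqF.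
rewrite -[X in expR X]mulNr expRM_natr; apply: lerXn2r; rewrite ?nnegrE ?expR_ge0 //.
apply: le_trans (expR_ge1Dx _); rewrite lerD2l lerN2.
have -> : w ^+ 3 / 8 = l%:R * (m - l)%:R / m%:R ^+ 2 * profile w.
  rewrite pE /w -x3 -y3; field; rewrite !gt_eqF //.
rewrite invfM mulrA mulrAC; apply: ler_wpM2l; last exact: profile_ge.
by rewrite divr_ge0 ?mulr_ge0 ?exprn_ge0.
Qed.

(** ** Small and large sets *)

Lemma inv_1B_exp_le (u : R) k : 0 <= u -> u <= 2^-1 ->
  ((1 - u) ^+ k)^-1 <= expR ((u + 2 * u ^+ 2) * k%:R).
Proof.
move=> u0 u1; rewrite expRM_natr -exprVn; have v0 : 0 < 1 - u by lra.
apply: lerXn2r; rewrite ?nnegrE ?expR_ge0 ?invr_ge0 ?(ltW v0) //.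
apply: le_trans (expR_ge1Dx _); rewrite -div1r ler_pdivrMr //.
have : 0 <= u ^+ 2 * (1 - 2 * u) by rewrite mulr_ge0 ?exprn_ge0 //; lra.
by rewrite !expr2; lra.
Qed.

(** The linear terms in u cancel, because the mean degree 2 + excess is 3 m / n. *)
Lemma even_sets_small (u : R) l : 0 < u -> u <= 2^-1 -> (l <= m)%N ->
  even_sets l <= 'C(m, l)%:R ^- 2 / u ^+ (3 * l) * expR (14 * n%:R * u ^+ 2).
Proof.
move=> u0 u1 lm; have v0 : 0 < 1 - u by lra.
have uv : u + (1 - u) = 1 by ring.
have C0 : 0 <= 'C(m, l)%:R ^- 2 :> R by rewrite invr_ge0 exprn_ge0.
apply: (le_trans (even_sets_chernoff u0 v0 uv lm)).
set c := _ ^- 2 in C0 *; set a := u ^+ _; set b := (1 - u) ^+ _.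
have a0 : 0 < a by exact: exprn_gt0.
have b0 : 0 <= b^-1 by rewrite invr_ge0 exprn_ge0 // ltW.
rewrite [X in X <= _](_ : _ = c / a * (mean_weight (1 - u - u) / b)); last first.
  by rewrite invfM; ring.
apply: ler_wpM2l; first by rewrite divr_ge0 // ltW.
have s01 : 0 <= 1 - u - u <= 1 by apply/andP; split; lra.
have s1 : - 1 <= 1 - u - u <= 1 by apply/andP; split; lra.
have hW := mean_weight_le s1; rewrite (ger0_norm (proj1 (andP s01))) in hW.
have hv : b^-1 <= expR ((u + 2 * u ^+ 2) * (3 * m)%:R).
  apply: le_trans (inv_1B_exp_le _ (ltW u0) u1).
  rewrite lef_pV2 ?posrE ?exprn_gt0 //; apply: ler_wiXn2l; try lra.
  by rewrite leq_mul2l leq_subr.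
have d0 : 0 < 1 + th * (1 - (1 - u - u)) by rewrite ltr_pwDl // mulr_ge0 //; lra.
have g0 := divr_ge0 (sqr_ge0 (1 - u - u)) (ltW d0).
have base : (1 + (1 - u - u) ^+ 2 / (1 + th * (1 - (1 - u - u)))) / 2 <=
    expR (- (2 + th) * u + 8 * u ^+ 2).
  apply: le_trans (expR_ge1Dx _).
  rewrite ler_pdivrMr // -lerBrDl ler_pdivrMr // -subr_ge0.
  have thu : 0 <= th * u by rewrite mulr_ge0 // ltW.
  have -> : ((1 + (- (2 + th) * u + 8 * u ^+ 2)) * 2 - 1) * (1 + th * (1 - (1 - u - u))) -
     (1 - u - u) ^+ 2 =
     u ^+ 2 * (12 - 8 * th - 4 * th ^+ 2) + 32 * u ^+ 2 * (th * u) by ring.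
  have u20 : 0 <= u ^+ 2 by exact: sqr_ge0.
  have th2 : th ^+ 2 <= 1 by exact: exprn_ile1.
  have q0 : 0 <= 12 - 8 * th - 4 * th ^+ 2.
    by move: th2 (th_le1); set z := th ^+ 2; set z' := th; lra.
  apply: addr_ge0; first exact: mulr_ge0.
  by apply: mulr_ge0 => //; apply: mulr_ge0.
apply: (le_trans (ler_wpM2r b0 hW)).
apply: le_trans (ler_wpM2r b0 (lerXn2r n _ _ base)) _; rewrite ?nnegrE ?expR_ge0 //.
  by rewrite mulr_ge0 // addr_ge0.
apply: le_trans (ler_wpM2l _ hv) _; first by rewrite exprn_ge0 ?expR_ge0.
rewrite -expRM_natr -expRD ler_expR natrM.
have h3 : 3 * m%:R = th * n%:R + 2 * n%:R :> R by rewrite excessE; ring.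
rewrite h3 -subr_ge0.
have -> : 14 * n%:R * u ^+ 2 - ((- (2 + th) * u + 8 * u ^+ 2) * n%:R +
   (u + 2 * u ^+ 2) * (th * n%:R + 2 * n%:R)) = 2 * n%:R * u ^+ 2 * (1 - th) by ring.
by rewrite !mulr_ge0 ?exprn_ge0 ?(ltW u0) ?(ltW nr_gt0) // subr_ge0.
Qed.

Lemma even_sets_large (v : R) l : 0 < v -> v <= 2^-1 -> (l <= m)%N ->
  even_sets l <= 10 / 9 / v ^+ (3 * (m - l)) * expR (n%:R * (6 * v - th / 20)).
Proof.
move=> v0 v1 lm; have u0 : 0 < 1 - v by lra.
have uv : 1 - v + v = 1 by ring.
apply: (le_trans (even_sets_chernoff u0 v0 uv lm)).
set c := _ ^- 2; set b := v ^+ _; set a := (1 - v) ^+ _.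
have b0 : 0 < b by exact: exprn_gt0.
have a0 : 0 <= a^-1 by rewrite invr_ge0 exprn_ge0 // ltW.
have c1 : c <= 1.
  by rewrite invf_le1 ?exprn_gt0 ?ltr0n ?bin_gt0 // exprn_ege1 // ler1n bin_gt0.
have c0 : 0 <= c by rewrite invr_ge0 exprn_ge0.
have s01 : - 1 <= v - (1 - v) <= 0 by apply/andP; split; lra.
have hW := mean_weight_neg s01.
have hu : a^-1 <= expR ((v + 2 * v ^+ 2) * (3 * m)%:R).
  apply: le_trans (inv_1B_exp_le _ (ltW v0) v1).
  rewrite lef_pV2 ?posrE ?exprn_gt0 //; apply: ler_wiXn2l; try lra.
  by rewrite leq_mul2l lm.
have th1 := th_le1; have th20 : 0 <= 1 - th / 20 by lra.
have base : (1 - th / 20) ^+ n <= expR (- (th / 20) * n%:R).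
  rewrite expRM_natr; apply: lerXn2r; rewrite ?nnegrE ?expR_ge0 //.
  exact: expR_ge1Dx.
rewrite [X in X <= _](_ : _ = b^-1 * (c * mean_weight (v - (1 - v)) / a)); last first.
  by rewrite invfM; ring.
rewrite [X in _ <= X](_ : _ = b^-1 * (10 / 9 * expR (n%:R * (6 * v - th / 20)))); last first.
  by ring.
apply: ler_wpM2l; first by rewrite invr_ge0 ltW.
have d0 : 0 <= 10 / 9 * (1 - th / 20) ^+ n by rewrite mulr_ge0 ?exprn_ge0 //; lra.
apply: (le_trans (ler_wpM2r a0 (ler_wpM2l c0 hW))).
apply: (le_trans (ler_wpM2r a0 (ler_wpM2r d0 c1))).
rewrite [X in X <= _](_ : _ = 10 / 9 * ((1 - th / 20) ^+ n * a^-1)); last by ring.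
apply: ler_wpM2l; first by lra.
apply: (le_trans (ler_wpM2r a0 base)).
apply: (le_trans (ler_wpM2l (expR_ge0 _) hu)).
rewrite -expRD ler_expR natrM.
have mnr : m%:R <= n%:R :> R by rewrite ler_nat.
have vv : v + 2 * v ^+ 2 <= 2 * v by nra.
have := ler_pM (_ : 0 <= v + 2 * v ^+ 2) (ltW mr_gt0) vv mnr.
rewrite addr_ge0 ?mulr_ge0 ?exprn_ge0 ?(ltW v0) // => /(_ isT).
by lra.
Qed.

(** The sizes l and m - l at most r are treated apart; r is about n^(1/8), far
    more than log n, which makes the sets of intermediate size negligible, and
    so small that the bounds for the sizes up to r are largest at size 1. *)
Section Cutoff.
Variables (r : nat) (eta : R).
Hypotheses (r_ge2 : (2 <= r)%N) (r_le : (r ^ 8 <= n)%N) (r_gt : (n < r.+1 ^ 8)%N).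
Hypotheses (eta0 : 0 < eta) (eta1 : eta <= 1).
Hypotheses (eta_th : eta <= th) (eta_m : eta * m%:R <= (n - m)%:R).

Let rr_ge2 : 2 <= r%:R :> R. Proof. by rewrite ler_nat. Qed.
Let rr_gt0 : 0 < r%:R :> R. Proof. by rewrite ltr0n (leq_trans _ r_ge2). Qed.

Lemma even_sets_small_cutoff l : (0 < l <= r)%N -> (l <= m)%N ->
  even_sets l <= expR (14 * 256) * (9 / 4) / r%:R ^+ 2.
Proof.
move=> /andP[l0 lr] lm; have l0r : 0 < l%:R :> R by rewrite ltr0n.
(* About n^(-1/2), so that n u^2 is bounded. *)
pose u : R := r%:R ^- 4; have u0 : 0 < u by rewrite invr_gt0 exprn_gt0.
have u1 : u <= 2^-1.
  rewrite lef_pV2 ?posrE ?exprn_gt0 // (le_trans rr_ge2) // ler_eXnr //.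
  by rewrite (le_trans _ rr_ge2) // ler1n.
apply: (le_trans (even_sets_small u0 u1 lm)); rewrite -[X in _ <= X]mulrA mulrC.
have b0 : 0 < 'C(m, l)%:R :> R by rewrite ltr0n bin_gt0.
apply: ler_pM.
- exact: expR_ge0.
- by rewrite divr_ge0 ?invr_ge0 ?exprn_ge0 ?(ltW u0).
- rewrite ler_expR -mulrA ler_pM2l // /u exprVn -exprM ler_pdivrMr ?exprn_gt0 //.
  rewrite -natrX -natrM ler_nat (leq_trans (ltnW r_gt)) //.
  have -> : (256 * r ^ (4 * 2) = (2 * r) ^ 8)%N by rewrite expnMn.
  by rewrite leq_exp2r // mul2n -addnn -addn1 leq_add2l (leq_trans _ r_ge2).
have hb : (m%:R / l%:R) ^+ l <= 'C(m, l)%:R :> R.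
  rewrite expr_div_n ler_pdivrMr ?exprn_gt0 // -!natrX -natrM ler_nat.
  exact: exp_le_bin.
have q0 : 0 < m%:R / l%:R :> R by rewrite divr_gt0.
have -> : u ^+ (3 * l) = ((r%:R ^+ 12) ^+ l)^-1.
  by rewrite /u exprVn -!exprM mulnA.
rewrite invrK; apply: (@le_trans _ _ ((m%:R / l%:R) ^- 2 ^+ l * (r%:R ^+ 12) ^+ l)).
  apply: ler_wpM2r; first by rewrite !exprn_ge0.
  rewrite exprVn lef_pV2 ?posrE ?exprn_gt0 // exprAC.
  by apply: lerXn2r; rewrite ?nnegrE ?exprn_ge0 ?(ltW b0) ?(ltW q0).
have step : (m%:R / l%:R) ^- 2 * r%:R ^+ 12 <= 9 / 4 / r%:R ^+ 2 :> R.
  have lrr : l%:R <= r%:R :> R by rewrite ler_nat.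
  have h1 : 2 / 3 * r%:R ^+ 8 <= m%:R :> R.
    have : (2 * r ^ 8 <= 3 * m)%N by rewrite (leq_trans _ nm) // leq_mul2l r_le.
    by rewrite -(ler_nat R) [(2 * _)%:R]natrM [(3 * _)%:R]natrM natrX; lra.
  have h2 : 2 / 3 * r%:R ^+ 7 <= m%:R / l%:R :> R.
    rewrite ler_pdivlMr // (le_trans _ h1) // -[X in X <= _]mulrA ler_pM2l; last by lra.
    by rewrite [r%:R ^+ 8]exprSr ler_wpM2l ?exprn_ge0.
  have h3 : (m%:R / l%:R) ^- 2 <= (2 / 3 * r%:R ^+ 7) ^- 2 :> R.
    have p0 : 0 < 2 / 3 * r%:R ^+ 7 :> R by rewrite mulr_gt0 ?exprn_gt0 //; lra.
    rewrite lef_pV2 ?posrE ?exprn_gt0 //.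
    by apply: lerXn2r; rewrite ?nnegrE ?(ltW p0) ?(ltW q0).
  apply: (le_trans (ler_wpM2r (exprn_ge0 12 (ltW rr_gt0)) h3)).
  by rewrite le_eqVlt; apply/orP; left; apply/eqP; field; rewrite gt_eqF.
rewrite -exprMn; apply: le_trans (step).
have s0 : 0 <= (m%:R / l%:R) ^- 2 * r%:R ^+ 12 :> R.
  by rewrite mulr_ge0 ?invr_ge0 ?exprn_ge0 // ltW.
have s1 : (m%:R / l%:R) ^- 2 * r%:R ^+ 12 <= 1 :> R.
  apply: (le_trans step); rewrite ler_pdivrMr ?exprn_gt0 // mul1r.
  by have r2 := rr_ge2; nra.
by rewrite -[X in _ <= X]expr1; apply: ler_wiXn2l.
Qed.

Lemma even_sets_middle_cutoff l : (r < l)%N -> (r < m - l)%N ->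
  even_sets l <= (r.+1%:R ^+ 16) * expR (- (eta / 4 * r%:R)).
Proof.
move=> rl rml; have l0m : (0 < l < m)%N.
  by rewrite -[(l < m)%N]subn_gt0 (leq_ltn_trans _ rl) // (leq_ltn_trans _ rml).
apply: (le_trans (even_sets_middle l0m)); apply: ler_pM.
- by rewrite exprn_ge0.
- exact: expR_ge0.
- have -> : r.+1%:R ^+ 16 = (r.+1%:R ^+ 8) ^+ 2 :> R by rewrite -exprM.
  rewrite lerXn2r ?nnegrE ?exprn_ge0 // -natrX ler_nat.
  by rewrite (leq_trans _ r_gt) // ltnS.
rewrite ler_expR lerN2 ler_pdivlMr ?mulr_gt0 ?exprn_gt0 //.
have h : (r * m <= 2 * (l * (m - l)))%N.
  have [k mE] : exists k, m = (l + k)%N by exists (m - l)%N; rewrite subnKC // ltnW //; case/andP: l0m.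
  move: rml; rewrite mE addKn => rk; rewrite mulnDr.
  rewrite mul2n -addnn; apply: leq_add; last by rewrite leq_mul2r (ltnW rl) orbT.
  by rewrite mulnC leq_mul2l (ltnW rk) orbT.
move: h; rewrite -(ler_nat R) !natrM => h.
have h' : eta * m%:R * (r%:R * m%:R) <= (n - m)%:R * (2 * (l%:R * (m - l)%:R)).
  by apply: ler_pM => //; rewrite mulr_ge0 // ltW.
by lra.
Qed.

Lemma even_sets_large_cutoff l : (l <= m)%N -> (m - l <= r)%N ->
  even_sets l <= 10 / 9 * expR (720 / eta * r%:R - eta / 40 * r%:R ^+ 8).
Proof.
(* The factor (1 - v)^(- 3 l) then costs half of the gain eta / 20. *)
move=> lm mlr; pose v := eta / 240.
have v0 : 0 < v by rewrite divr_gt0.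
have v1 : v <= 2^-1 by rewrite /v; have := eta1; lra.
apply: (le_trans (even_sets_large v0 v1 lm)); rewrite -mulrA.
apply: ler_wpM2l; first by lra.
rewrite expRD.
apply: ler_pM; rewrite ?expR_ge0 ?invr_ge0 ?exprn_ge0 ?(ltW v0) //.
  rewrite -exprVn /v invf_div.
  have K1 : 1 <= 240 / eta by rewrite ler_pdivlMr // mul1r; have := eta1; lra.
  apply: (@le_trans _ _ ((240 / eta) ^+ (3 * r))).
    by apply: ler_weXn2l => //; rewrite leq_mul2l.
  have -> : 720 / eta * r%:R = 240 / eta * (3 * r)%:R by rewrite natrM; ring.
  rewrite expRM_natr; apply: lerXn2r; rewrite ?nnegrE ?expR_ge0 ?(le_trans _ K1) //.
  by apply: le_trans (expR_ge1Dx _); rewrite lerDr.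
rewrite ler_expR.
have h : 6 * v - th / 20 <= - (eta / 40) by rewrite /v; have := eta_th; lra.
apply: (le_trans (ler_wpM2l (ltW nr_gt0) h)).
rewrite mulrN mulrC lerN2; apply: ler_wpM2l; first by have := eta0; lra.
by rewrite -natrX ler_nat.
Qed.

End Cutoff.
End EvenSets.

(** * The sum over the grid *)

Section Grid.
Variables (R : realType) (m n : nat).
Hypotheses (m_gt0 : (0 < m)%N) (n_gt0 : (0 < n)%N).

Let mr_gt0 : 0 < m%:R :> R. Proof. by rewrite ltr0n. Qed.
Let nr_gt0 : 0 < n%:R :> R. Proof. by rewrite ltr0n. Qed.

Definition grid_point (p : 'I_m.+1 * 'I_n.+1) : R * R :=
  (1 - 2 / (3 * m%:R) * p.1%:R, n%:R^-1 * p.2%:R).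

Lemma grid_point_inj : injective grid_point.
Proof.
move=> [l j] [l' j'] [] /= /addrI/oppr_inj h1 h2.
have d0 : 2 / (3 * m%:R) != 0 :> R by rewrite mulf_neq0 ?invr_neq0 ?mulf_neq0 ?lt0r_neq0.
have := mulfI d0 h1; have := mulfI (invr_neq0 (lt0r_neq0 nr_gt0)) h2.
by move=> /eqP; rewrite eqr_nat => /eqP/val_inj -> /eqP; rewrite eqr_nat => /eqP/val_inj ->.
Qed.

Lemma grid_point_in p : (What R `&` Lambda R m n) (grid_point p).
Proof.
case: p => l j; have lm : l%:R <= m%:R :> R by rewrite ler_nat -ltnS.
have jn : j%:R <= n%:R :> R by rewrite ler_nat -ltnS.
have d0 : 0 <= 2 / (3 * m%:R) :> R by rewrite divr_ge0 // mulr_ge0 // ltW.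
split; rewrite /What /grid_point /=.
  have h : 2 / (3 * m%:R) * l%:R <= 2 / 3 :> R.
    apply: (le_trans (ler_wpM2l d0 lm)); rewrite le_eqVlt; apply/orP; left.
    by apply/eqP; field; rewrite gt_eqF.
  have h' : 0 <= 2 / (3 * m%:R) * l%:R :> R by rewrite mulr_ge0.
  apply/andP; split; first by apply/andP; split; lra.
  by rewrite mulr_ge0 ?invr_ge0 //= mulrC ler_pdivrMr // mul1r.
exists (- l%:Z), j%:Z; rewrite mulrNz mulrN -!pmulrn.
by congr pair; ring.
Qed.

Lemma sum_grid (F : R * R -> R) :
  \sum_(x \in What R `&` Lambda R m n) F x =
  \sum_(l < m.+1) \sum_(j < n.+1) F (grid_point (l, j)).
Proof.
pose r := [seq grid_point p | p <- index_enum (('I_m.+1 * 'I_n.+1)%type : finType)].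
have ur : uniq r by rewrite map_inj_uniq ?index_enum_uniq //; exact: grid_point_inj.
have -> : What R `&` Lambda R m n = [set` r].
  apply/seteqP; split=> x /=.
    move=> /(grid_param m_gt0 n_gt0)[l [j ->]].
    by apply/mapP; exists (l, j); rewrite ?mem_index_enum.
  by move=> /mapP[p _ ->]; exact: grid_point_in.
by rewrite -fsbig_seq // big_map pair_bigA /=; apply: eq_bigr => -[].
Qed.

Lemma truncn_nat (x : R) k : x = k%:R -> Num.truncn x = k.
Proof. by move=> ->; rewrite natrK. Qed.

Lemma Smn_grid (l : 'I_m.+1) (j : 'I_n.+1) :
  Smn m n (grid_point (l, j)) = n%:R * (2 ^+ m / 2 ^+ n) * 3 ^+ l * 'C(m, l)%:R *
    ((S2 (3 * m - 2 * l) j)%:R * (S2 (2 * l) (n - j))%:R / (S2 (3 * m) n)%:R).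
Proof.
have lm : (l <= m)%N by rewrite -ltnS.
have jn : (j <= n)%N by rewrite -ltnS.
have m0 : m%:R != 0 :> R by rewrite lt0r_neq0.
have n0 : n%:R != 0 :> R by rewrite lt0r_neq0.
have e1 : 3 / 2 * (1 - (1 - 2 / (3 * m%:R) * l%:R)) * m%:R = l%:R :> R by field.
have e2 : 3 * (1 - 2 / (3 * m%:R) * l%:R) * m%:R = (3 * m - 2 * l)%:R :> R.
  by rewrite natrB ?leq_mul // !natrM; field.
have e3 : 3 * (1 - (1 - 2 / (3 * m%:R) * l%:R)) * m%:R = (2 * l)%:R :> R.
  by rewrite natrM; field.
have e4 : n%:R^-1 * j%:R * n%:R = j%:R :> R by field.
have e5 : (1 - n%:R^-1 * j%:R) * n%:R = (n - j)%:R :> R by rewrite natrB //; field.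
rewrite /Smn /grid_point /= e1 (truncn_nat e2) (truncn_nat e3) (truncn_nat e4) (truncn_nat e5).
rewrite (truncn_nat (erefl l%:R)) powR_mulrn //; congr (_ * _ * _ * _ * _).
by rewrite powRB ?powR_mulrn // pnatr_eq0 implybT.
Qed.

Lemma sum_Smn : (m <= n)%N -> (2 * n <= 3 * m)%N ->
  n%:R^-1 * \sum_(x \in What R `&` Lambda R m n) Smn m n x =
  \sum_(l < m.+1) even_sets R m n l.
Proof.
move=> mn nm; rewrite sum_grid.
set N := (3 * m)%N; pose f := blockser R N.
have U_gt0 : 0 < (f ^+ n)`_N by exact: blockser_exp_gt0.
transitivity (2 ^+ m / 2 ^+ n * \sum_(l < m.+1) \sum_(j < n.+1)
  3 ^+ l * 'C(m, l)%:R * ((S2 (N - 2 * l) j)%:R * (S2 (2 * l) (n - j))%:R / (S2 N n)%:R) : R).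
  rewrite !mulr_sumr; apply: eq_bigr => l _; rewrite !mulr_sumr; apply: eq_bigr => j _.
  rewrite Smn_grid -/N; move: (2 ^+ n) (S2 N n)%:R => a b.
  by rewrite !mulrA mulVf ?lt0r_neq0 // mul1r.
have -> : \sum_(l < m.+1) even_sets R m n l =
    (\sum_(l < m.+1) 'C(m, l)%:R / 'C(3 * m, 3 * l)%:R
     * (even_enum f n (3 * m))`_(3 * l)) / (2 ^+ n * (f ^+ n)`_N).
  by rewrite mulr_suml; apply: eq_bigr => l _; rewrite /even_sets mulrA.
rewrite duality -/N; set rhs := (X in _ = _ * X / _).
rewrite [RHS](_ : _ = 2 ^+ m / 2 ^+ n * (rhs / (f ^+ n)`_N)); last by rewrite invfM; ring.
congr (_ * _); rewrite /rhs mulr_suml.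
apply: eq_bigr => l _; have lm : (l <= m)%N by rewrite -ltnS.
have lN : (2 * l <= N)%N by rewrite /N; lia.
rewrite /split_coef mulr_sumr mulr_suml; apply: eq_bigr => j _.
have jn : (j <= n)%N by rewrite -ltnS.
rewrite !(@S2_blockser R N) -/f; try lia.
have := bin_fact_R R lN; have := bin_fact_R R jn; rewrite -/N => -> ->.
set X := (f ^+ j)`__; set Y := (f ^+ (n - j))`__; set U := (f ^+ n)`_N.
by field; rewrite !fact_neq0 lt0r_neq0.
Qed.
End Grid.

(** * Convergence *)

Section Decay.
Variable R : realType.

Lemma poly_exp_decay (p : nat) (c : R) : 0 < c ->
  exists2 C : R, 0 <= C & forall r : nat, (0 < r)%N ->
    r.+1%:R ^+ p * expR (- (c * r%:R)) <= C / r%:R.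
Proof.
move=> c0; pose d := c / p.+1%:R; have d0 : 0 < d by rewrite divr_gt0.
exists (2 ^+ p / d ^+ p.+1) => [|r r0].
  by rewrite divr_ge0 // exprn_ge0 // ltW.
have rr0 : 0 < r%:R :> R by rewrite ltr0n.
rewrite expRN.
have h1 : (d * r%:R) ^+ p.+1 <= expR (c * r%:R).
  have -> : c * r%:R = (d * r%:R) * p.+1%:R by rewrite /d mulrAC divfK // pnatr_eq0.
  rewrite expRM_natr; apply: lerXn2r.
  - by rewrite nnegrE mulr_ge0 // ltW.
  - by rewrite nnegrE expR_ge0.
  by apply: le_trans (expR_ge1Dx _); rewrite lerDr.
have h2 : r.+1%:R ^+ p <= 2 ^+ p * r%:R ^+ p :> R.
  by rewrite -exprMn; apply: lerXn2r; rewrite ?nnegrE // -natrM ler_nat; lia.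
have d1 : 0 < (d * r%:R) ^+ p.+1 by rewrite exprn_gt0 // mulr_gt0.
have h3 : (expR (c * r%:R))^-1 <= ((d * r%:R) ^+ p.+1)^-1.
  by rewrite lef_pV2 // posrE ?expR_gt0.
apply: (le_trans (ler_pM _ _ h2 h3)); rewrite ?exprn_ge0 ?invr_ge0 ?expR_ge0 //.
rewrite exprMn [r%:R ^+ p.+1]exprS le_eqVlt; apply/orP; left; apply/eqP.
by field; rewrite !expf_neq0 ?lt0r_neq0.
Qed.

Lemma pow8_exp_decay (p : nat) (K a : R) : 0 < a -> 
  exists2 C : R, 0 <= C & forall r : nat, (0 < r)%N ->
    r.+1%:R ^+ p * expR (K * r%:R - a * r%:R ^+ 8) <= C / r%:R.
Proof.
move=> a0; have [C C0 hC] := @poly_exp_decay p 1 ltr01.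
pose k := expR ((K + 1) ^+ 2 / (4 * a)); exists (k * C) => [|r r0].
  by rewrite mulr_ge0 ?expR_ge0.
have r1 : 1 <= r%:R :> R by rewrite ler1n.
have le_exp : K * r%:R - a * r%:R ^+ 8 <= (K + 1) ^+ 2 / (4 * a) - 1 * r%:R.
  have h8 : a * r%:R ^+ 2 <= a * r%:R ^+ 8.
    by apply: ler_wpM2l; [exact: ltW | exact: ler_weXn2l].
  suff h : (K + 1) * r%:R - a * r%:R ^+ 2 <= (K + 1) ^+ 2 / (4 * a) by lra.
  rewrite ler_pdivlMr ?mulr_gt0 // -subr_ge0.
  have -> : (K + 1) ^+ 2 - ((K + 1) * r%:R - a * r%:R ^+ 2) * (4 * a) =
    (K + 1 - 2 * a * r%:R) ^+ 2 by ring.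
  exact: sqr_ge0.
rewrite -ler_expR [X in _ <= X]expRD -/k in le_exp.
apply: (le_trans (ler_wpM2l (exprn_ge0 p (ler0n R _)) le_exp)).
by rewrite mulrCA -mulrA; apply: ler_wpM2l; [exact: expR_ge0 | exact: hC].
Qed.

(** At most r small sizes contribute O(1 / r^2) each; the m other sizes are
    negligible because m <= n < (r + 1)^8 is polynomial in r. *)
Lemma even_sets_sum_bound (eta : R) : 0 < eta -> eta <= 1 ->
  exists2 C : R, 0 <= C & forall m n r : nat,
    (0 < m)%N -> (m <= n)%N -> (2 * n <= 3 * m)%N ->
    (2 <= r)%N -> (r ^ 8 <= n)%N -> (n < r.+1 ^ 8)%N ->
    eta <= excess R n (3 * m) -> eta * m%:R <= (n - m)%:R ->
    `|\sum_(l < m.+1) even_sets R m n l - 1| <= C / r%:R.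
Proof.
move=> e0 e1; have e4 : 0 < eta / 4 by rewrite divr_gt0.
have e40 : 0 < eta / 40 by rewrite divr_gt0.
have [C1 C1_ge0 h1] := @poly_exp_decay 24 (eta / 4) e4.
have [C2 C2_ge0 h2] := @pow8_exp_decay 8 (720 / eta) (eta / 40) e40.
set a : R := expR (14 * 256) * (9 / 4).
have a0 : 0 <= a by rewrite mulr_ge0 ?expR_ge0 //; lra.
exists (a + C1 + 10 / 9 * C2) => [|m n r m0 mn nm r2 rn nr eth em].
  by rewrite !addr_ge0 // mulr_ge0 //; lra.
have r0 : (0 < r)%N by rewrite (leq_trans _ r2).
have rr0 : 0 < r%:R :> R by rewrite ltr0n.
rewrite big_ord_recl even_sets0 // addrC addKr ger0_norm; last first.
  by apply: sumr_ge0 => l _; exact: even_sets_ge0.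
pose b : R := r.+1%:R ^+ 16 * expR (- (eta / 4 * r%:R)).
pose c : R := 10 / 9 * expR (720 / eta * r%:R - eta / 40 * r%:R ^+ 8).
have b0 : 0 <= b by rewrite mulr_ge0 ?exprn_ge0 ?expR_ge0.
have c0 : 0 <= c by rewrite mulr_ge0 ?expR_ge0 //; lra.
have each (l : 'I_m) : even_sets R m n (lift ord0 l) <=
    (if (l < r)%N then a / r%:R ^+ 2 else 0) + (b + c).
  rewrite lift0; have lm : (l.+1 <= m)%N by [].
  case: ifP => lr.
    apply: (le_trans (even_sets_small_cutoff R m0 mn nm r2 rn nr _ lm)); first by [].
    by rewrite lerDl addr_ge0.
  rewrite add0r; case: (leqP (m - l.+1) r) => mlr.
    by apply: (le_trans (even_sets_large_cutoff m0 mn nm rn e0 e1 eth lm mlr)); rewrite lerDr.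
  apply: (le_trans (even_sets_middle_cutoff m0 mn nm nr e0 em _ mlr)).
    by rewrite ltnS leqNgt lr.
  by rewrite lerDl.
apply: (le_trans (ler_sum _ (fun l _ => each l))).
rewrite big_split /= sumr_const card_ord -[(b + c) *+ m]mulr_natl.
have m8 : m%:R <= r.+1%:R ^+ 8 :> R.
  by rewrite -natrX ler_nat (leq_trans mn) // ltnW.
have hA : \sum_(l < m) (if (l < r)%N then a / r%:R ^+ 2 else 0) <= a / r%:R.
  have -> : a / r%:R = r%:R * (a / r%:R ^+ 2) by field; rewrite lt0r_neq0.
  have q0 : 0 <= a / r%:R ^+ 2 by rewrite divr_ge0 ?exprn_ge0.
  rewrite -big_mkcond /=; case: (leqP r m) => rm.
    rewrite (big_ord_narrow rm) /=. by rewrite big_const_ord iter_addr_0 mulr_natl.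
  apply: (@le_trans _ _ (\sum_(l < m) a / r%:R ^+ 2)).
    by rewrite big_mkcond; apply: ler_sum => l _; case: ifP.
  by rewrite sumr_const card_ord -[_ *+ m]mulr_natl ler_wpM2r // ler_nat ltnW.
have hB : m%:R * b <= C1 / r%:R.
  apply: le_trans (h1 r r0); rewrite -[24%N]/(8 + 16)%N exprD -mulrA.
  by apply: ler_wpM2r.
have hC : m%:R * c <= 10 / 9 * C2 / r%:R.
  rewrite -[X in _ <= X]mulrA /c mulrCA; apply: ler_wpM2l; first by lra.
  by apply: le_trans (h2 r r0); apply: ler_wpM2r; rewrite ?expR_ge0.
rewrite mulrDr !mulrDl; lra.
Qed.
End Decay.

Lemma eighth_root_floor n : exists r, (r ^ 8 <= n < r.+1 ^ 8)%N.
Proof.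
have ex0 : exists r, (r ^ 8 <= n)%N by exists 0%N.
have bnd r : (r ^ 8 <= n)%N -> (r <= n)%N.
  by apply: leq_trans; case: r => // r; rewrite expnS leq_pmulr // expn_gt0.
case: (ex_maxnP ex0 bnd) => r rn maxr; exists r; rewrite rn /= ltnNge.
by apply/negP => /maxr; rewrite ltnn.
Qed.

Theorem theorem3p1 (R : realType) (m n : nat -> nat)
    (m_gt0 : forall k, (0 < m k)%N) (n_gt0 : forall k, (0 < n k)%N)
    (m_ge : forall k, (k <= m k)%N) (n_ge : forall k, (k <= n k)%N)
    (l : R) (l_gt : 2 / 3 < l) (l_lt : l < 1)
    (mn_cvg : ((m k)%:R / (n k)%:R : R) @[k --> \oo] --> l) :
  ((n k)%:R^-1 * \sum_(x \in What R `&` Lambda R (m k) (n k))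
                   Smn (m k) (n k) x : R) @[k --> \oo] --> (1 : R).
Proof.
(* A margin that m k / n k eventually keeps from 2 / 3 and from 1. *)
pose eta := Num.min (l - 2 / 3) (1 - l) / 2.
have eta0 : 0 < eta by rewrite divr_gt0 // lt_min; apply/andP; split; lra.
have etal : eta <= (l - 2 / 3) / 2 by rewrite ler_pM2r // ge_min lexx.
have eta1 : eta <= (1 - l) / 2 by rewrite ler_pM2r // ge_min lexx orbT.
have eta_le1 : eta <= 1 by lra.
have [C C0 bound] := even_sets_sum_bound eta0 eta_le1.
apply/cvgrPdist_le => eps eps0.
pose r0 := (2 + Num.truncn (C / eps)).+1.
have /cvgrPdist_le/(_ _ eta0) near_l := mn_cvg.
near=> k.
have nr_gt0 : 0 < (n k)%:R :> R by rewrite ltr0n.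
have : `|l - (m k)%:R / (n k)%:R| <= eta by near: k.
rewrite ler_norml => /andP[c_le c_ge].
have c1 : (m k)%:R / (n k)%:R <= 1 - eta by lra.
have c2 : 2 / 3 + eta <= (m k)%:R / (n k)%:R by lra.
rewrite ler_pdivrMr // in c1; rewrite ler_pdivlMr // in c2.
have en : 0 < eta * (n k)%:R by rewrite mulr_gt0.
have mn : (m k <= n k)%N by rewrite -(ler_nat R); lra.
have nm : (2 * n k <= 3 * m k)%N by rewrite -(ler_nat R) !natrM; lra.
have [r /andP[rn nr]] := eighth_root_floor (n k).
have r0_le : (r0 <= r)%N.
  rewrite -ltnS -(@ltn_exp2r _ _ 8) // (leq_ltn_trans _ nr) //.
  by rewrite (leq_trans _ (n_ge k)) //; near: k; exact: nbhs_infty_ge.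
have r2 : (2 <= r)%N by rewrite (leq_trans _ r0_le).
rewrite sum_Smn // distrC.
apply: (le_trans (bound _ _ r (m_gt0 k) mn nm r2 rn nr _ _)).
- by rewrite /excess ler_pdivlMr // natrB // !natrM; lra.
- rewrite natrB //; have : eta * (m k)%:R <= eta * (n k)%:R by rewrite ler_pM2l // ler_nat.
  by lra.
have rr0 : 0 < r%:R :> R by rewrite ltr0n (leq_trans _ r2).
rewrite ler_pdivrMr // mulrC -ler_pdivrMr //.
apply: (@le_trans _ _ r0%:R); last by rewrite ler_nat.
by apply: ltW; rewrite -truncn_le_nat leq_addl.
Unshelve. all: by end_near.
Qed.
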